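(* Let $\mathbb{K}$ be a countably infinite field and consider the $\mathbb{K}^*$-action on $\widehat{\mathbb{K}}\times\widehat{\mathbb{K}}$ given by $$a.(\xi_1,\xi_2) = (a^*\xi_1, (a^{-1})^*\xi_2), \quad a \in \mathbb{K}^*, \ (\xi_1,\xi_2) \in \widehat{\mathbb{K}}\times\widehat{\mathbb{K}}.$$ Then this action has exactly four ergodic invariant probability measures: $$\delta_1\otimes\delta_1, \quad \delta_1\otimes m_{\widehat{\mathbb{K}}}, \quad m_{\widehat{\mathbb{K}}}\otimes\delta_1, \quad m_{\widehat{\mathbb{K}}}\otimes m_{\widehat{\mathbb{K}}}.$$
   Context: $\mathbb{K}$ is given the discrete topology, $\widehat{\mathbb{K}} = \operatorname{Hom}((\mathbb{K},+),\mathbb{S}^1)$ is the compact Pontryagin dual of its additive group, $m_{\widehat{\mathbb{K}}}$ its Haar probability measure, and $\delta_1$ the point mass at the trivial character $1$. For $a\in\mathbb{K}^*$, $a^*$ is the automorphism of $\widehat{\mathbb{K}}$ given by $(a^*\xi)(b) = \xi(ab)$ for $b \in \mathbb{K}$. Probability measures are Borel probability measures. *)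

(* Defs.v *)
From HB Require Import structures.
From mathcomp Require Import all_boot all_order all_algebra complex.
From mathcomp Require Import all_classical all_reals all_analysis.

Set Implicit Arguments.
Unset Strict Implicit.
Unset Printing Implicit Defensive.

Import Order.TTheory GRing.Theory Num.Theory.

Local Open Scope classical_set_scope.
Local Open Scope ring_scope.

(* The elements of Hom((K, +), S^1), with S^1 the unit circle of R[i].  Since K
   is discrete, every such homomorphism is continuous. *)
Record pdual (R : realType) (K : fieldType) := Dual {
  dual_fun :> K -> R[i];
  dual_norm : forall b, `|dual_fun b| = 1;
  dualD : forall b c, dual_fun (b + c) = dual_fun b * dual_fun c
}.

Section dual_group.
Variables (R : realType) (K : fieldType).
Local Notation D := (pdual R K).
Implicit Types xi chi : D.

Lemma dualP xi chi : xi =1 chi -> xi = chi.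
Proof.
case: xi chi => [f f1 fD] [g g1 gD] /= /funext fg; subst g.
by congr Dual; exact: Prop_irrelevance.
Qed.

Lemma dual_neq0 xi b : xi b != 0.
Proof. by rewrite -normr_eq0 dual_norm oner_eq0. Qed.

Fact dual_one_norm (b : K) : `|1 : R[i]| = 1.
Proof. exact: normr1. Qed.
Fact dual_oneD (b c : K) : 1 = 1 * 1 :> R[i].
Proof. by rewrite mulr1. Qed.
Definition dual_one : D := Dual dual_one_norm dual_oneD.

Fact dual_mul_norm xi chi b : `|xi b * chi b| = 1.
Proof. by rewrite normrM !dual_norm mulr1. Qed.
Fact dual_mulD xi chi b c :
  xi (b + c) * chi (b + c) = (xi b * chi b) * (xi c * chi c).
Proof. by rewrite !dualD mulrACA. Qed.
Definition dual_mul xi chi : D :=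
  Dual (dual_mul_norm xi chi) (dual_mulD xi chi).

Fact dual_inv_norm xi b : `|(xi b)^-1| = 1.
Proof. by rewrite normfV dual_norm invr1. Qed.
Fact dual_invD xi b c : (xi (b + c))^-1 = (xi b)^-1 * (xi c)^-1.
Proof. by rewrite dualD invfM. Qed.
Definition dual_inv xi : D := Dual (dual_inv_norm xi) (dual_invD xi).

HB.instance Definition _ := gen_eqMixin D.
HB.instance Definition _ := gen_choiceMixin D.

Fact dual_mulA : associative dual_mul.
Proof. by move=> ? ? ?; apply: dualP => b /=; rewrite mulrA. Qed.
Fact dual_mul1 : left_id dual_one dual_mul.
Proof. by move=> ?; apply: dualP => b /=; rewrite mul1r. Qed.
Fact dual_mulr1 : right_id dual_one dual_mul.
Proof. by move=> ?; apply: dualP => b /=; rewrite mulr1. Qed.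
Fact dual_mulV : left_inverse dual_one dual_inv dual_mul.
Proof. by move=> xi; apply: dualP => b /=; rewrite mulVf// dual_neq0. Qed.
Fact dual_mulrV : right_inverse dual_one dual_inv dual_mul.
Proof. by move=> xi; apply: dualP => b /=; rewrite mulfV// dual_neq0. Qed.

HB.instance Definition _ :=
  isGroup.Build D dual_mulA dual_mul1 dual_mulr1 dual_mulV dual_mulrV.

HB.instance Definition _ := isPointed.Build D 1%g.

(* K being discrete, the compact-open topology on the dual is the topology of
   pointwise convergence. *)
HB.instance Definition _ := Topological.copy D
  (initial_topology (@dual_fun R K : D -> {ptws K -> R[i]^o})).

Definition dual_borel : set (set D) := <<s @open D >>.

Fact dual_borel0 : dual_borel set0.
Proof. exact: sigma_algebra0. Qed.
Fact dual_borelC A : dual_borel A -> dual_borel (~` A).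
Proof. exact: sigma_algebraC. Qed.
Fact dual_borelU (F : (set D)^nat) :
  (forall i, dual_borel (F i)) -> dual_borel (\bigcup_i F i).
Proof. exact: sigma_algebra_bigcup. Qed.

Definition dual_display : measure_display.
Proof. by constructor. Qed.

HB.instance Definition _ := @isMeasurable.Build dual_display D dual_borel
  dual_borel0 dual_borelC dual_borelU.

(* For countable K, the product sigma-algebra carried by D * D is its Borel
   sigma-algebra (measurable_dualX): D has the countable basis formed by the
   finite intersections of sets {xi | |xi b - (p + iq)| < 1/(n+1)}, p, q in Q. *)
Let ball_ix : Type := (K * rat * rat * nat)%type.
Let ratC (p q : rat) : R[i] := Complex (ratr p) (ratr q).
Let sub_ball (t : ball_ix) : set D :=
  [set xi | `|xi t.1.1.1 - ratC t.1.1.2 t.1.2| < t.2.+1%:R^-1].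
Let basic (s : seq ball_ix) : set D :=
  [set xi | forall t, t \in s -> sub_ball t xi].

Lemma eval_continuous (b : K) : continuous (fun xi : D => xi b : R[i]^o).
Proof.
move=> xi; apply: (@continuous_comp D {ptws K -> R[i]^o} R[i]^o
  (@dual_fun R K) (fun f => f b)).
  exact: initial_continuous.
exact: (@proj_continuous K (fun=> R[i]^o) b).
Qed.

Let ball_open (z : R[i]) (e : R[i]) :
  open ([set w | `|w - z| < e] : set R[i]^o).
Proof.
rewrite openE => w /= wz.
exists (e - `|w - z|); first by rewrite /= subr_gt0.
move=> y /=; rewrite ltrBrDr => /(le_lt_trans _); apply.
rewrite [X in _ <= X + _]distrC.
by rewrite -[y - z](subrKA w) ler_normD.
Qed.

Let sub_ball_open t : open (sub_ball t).
Proof.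
apply: (@open_comp D R[i]^o (fun xi : D => xi t.1.1.1 : R[i]^o)
  [set w | `|w - ratC t.1.1.2 t.1.2| < t.2.+1%:R^-1]).
  by move=> xi _; exact: eval_continuous.
exact: ball_open.
Qed.

Let basic_open s : open (basic s).
Proof.
elim: s => [|t s IH].
  by rewrite (_ : basic _ = setT); [exact: openT|apply/seteqP; split].
rewrite (_ : basic _ = sub_ball t `&` basic s); first exact: openI.
apply/seteqP; split => [xi h|xi [h1 h2] u].
  split; first by apply: h; rewrite mem_head.
  by move=> u us; apply: h; rewrite inE us orbT.
by rewrite inE => /orP[/eqP->//|]; exact: h2.
Qed.

Let ratC_dense (z : R[i]) (n : nat) :
  exists p q, `|z - ratC p q| < n.+1%:R^-1.
Proof.
case: z => x y.
have d0 : (0 < (2 * n.+1%:R)^-1 :> R) by rewrite invr_gt0 mulr_gt0.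
have [p hp] : exists p : rat, `|x - ratr p| < (2 * n.+1%:R)^-1.
  have := @rat_in_itvoo R (x - (2 * n.+1%:R)^-1) (x + (2 * n.+1%:R)^-1).
  case; first by rewrite ltrBlDr -addrA ltrDl addr_gt0.
  by move=> p; rewrite in_itv/= => hp; exists p; rewrite distrC ltr_distl.
have [q hq] : exists q : rat, `|y - ratr q| < (2 * n.+1%:R)^-1.
  have := @rat_in_itvoo R (y - (2 * n.+1%:R)^-1) (y + (2 * n.+1%:R)^-1).
  case; first by rewrite ltrBlDr -addrA ltrDl addr_gt0.
  by move=> q; rewrite in_itv/= => hq; exists q; rewrite distrC ltr_distl.
exists p, q.
have -> : Complex x y - ratC p q =
    Complex (x - ratr p) 0 + Complex 0 (y - ratr q).
  by apply/eqP; rewrite eq_complex /= addr0 add0r !eqxx.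
apply: (le_lt_trans (ler_normD _ _)).
rewrite !normc_def /= !expr0n /= addr0 add0r !sqrtr_sqr.
rewrite -rmorphD /= -(rmorph_nat (real_complex R)) -fmorphV /= ltcR.
apply: (lt_le_trans (ltrD hp hq)).
by rewrite invfM mulrC -splitr.
Qed.

Let basic_nbhs (xi : D) (W : set D) :
  nbhs xi W -> exists2 s, basic s xi & basic s `<=` W.
Proof.
pose F : set_system D := filter_from [set s | basic s xi] basic.
have FF : Filter F.
  apply: filter_from_filter; first by exists [::].
  move=> s t sx tx; exists (s ++ t).
    by move=> u; rewrite mem_cat => /orP[]; [exact: sx|exact: tx].
  by move=> chi h; split=> u us; apply: h; rewrite mem_cat us ?orbT.
suff Fxi : F --> xi.
  by move=> /Fxi [s]; exists s.
move=> {}W; rewrite nbhsE => -[_ [[V oV <-] Vxi] VW].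
have {oV Vxi} nV : nbhs (dual_fun xi : {ptws K -> R[i]^o}) V.
  exact: open_nbhs_nbhs.
apply: filterS VW _.
have FG : Filter ((@dual_fun R K : D -> {ptws K -> R[i]^o}) @ F).
  exact: fmap_filter.
suff : (@dual_fun R K : D -> {ptws K -> R[i]^o}) @ F -->
       (dual_fun xi : {ptws K -> R[i]^o}) by apply.
apply/cvg_sup => b U; rewrite nbhsE => -[_ [[A oA <-] /= Axi] AU].
apply: filterS AU _.
move: oA; rewrite openE => /(_ _ Axi) [e /= e0 eA].
have [n hn] : exists n : nat, n.+1%:R^-1 + n.+1%:R^-1 < e.
  case: e e0 {eA} => e1 e2; rewrite ltcE /= => /andP[/eqP -> e10].
  have [n _ /(_ _ (leqnn n)) hn] := near_infty_natSinv_lt (PosNum (divr_gt0 e10 (ltr0Sn R 1))).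
  exists n; rewrite -(rmorph_nat (real_complex R)) -fmorphV -rmorphD.
  by rewrite ltcR (splitr e1) ltrD.
have [p [q pq]] := ratC_dense (xi b) n.
exists [:: (b, p, q, n)].
  by move=> t; rewrite inE => /eqP ->.
move=> chi /(_ (b, p, q, n)); rewrite inE eqxx => /(_ isT) h.
apply: eA => /=; apply: le_lt_trans hn.
rewrite -[xi b - chi b](subrKA (ratC p q)).
by apply: (le_trans (ler_normD _ _)); apply: lerD; [|rewrite distrC]; exact: ltW.
Qed.

Lemma measurable_dualX : countable [set: K] ->
  @measurable _ (D * D)%type = <<s @open (D * D)%type >>.
Proof.
move=> Kc; apply/seteqP; split; last first.
  apply: smallest_sub.
    exact: sigma_algebra_measurable.
  move=> W oW.
  pose I := [set st : seq ball_ix * seq ball_ix |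
    basic st.1 `*` basic st.2 `<=` W].
  have -> : W = \bigcup_(st in I) (basic st.1 `*` basic st.2).
    apply/seteqP; split; last by move=> z [st Ist /Ist].
    move=> z Wz; have : nbhs z W by exact: open_nbhs_nbhs.
    move=> [[P Q] /= [nP nQ] PQ].
    have [s sz sP] := basic_nbhs nP; have [t tz tQ] := basic_nbhs nQ.
    by exists (s, t) => // y [/sP ? /tQ ?]; exact: PQ.
  rewrite bigcup_mkcond; apply: countable_bigcupT_measurable.
    have /countable_injP[f fT] := Kc.
    have fI : injective f by move=> a b; apply: fT; rewrite in_setT.
    apply/countable_injP.
    pose g (t : ball_ix) := (f t.1.1.1, t.1.1.2, t.1.2, t.2).
    have gI : injective g.
      by move=> [[[a p] q] n] [[[b p'] q'] n'] [] /fI -> -> -> ->.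
    exists (fun st => pickle (map g st.1, map g st.2)).
    move=> [s t] [s' t'] _ _ /(pcan_inj pickleK) [].
    by move=> /(inj_map gI) -> /(inj_map gI) ->.
  move=> st; case: ifP => // _; apply: measurableX;
    by apply: sub_sigma_algebra; exact: basic_open.
rewrite measurable_prod_measurableType.
apply: smallest_sub; first exact: smallest_sigma_algebra.
move=> _ [A mA] [B mB] <-.
have pre (f : D * D -> D) : continuous f -> forall A', measurable A' ->
    <<s @open (D * D)%type >> (f @^-1` A').
  move=> /continuousP cf A'.
  suff : measurable `<=` [set A | <<s @open (D * D)%type >> (f @^-1` A)] by apply.
  apply: smallest_sub => [|U oU]; last first.
    by apply: sub_sigma_algebra; exact: cf.
  split => [|U|F] /=.
  - by rewrite preimage_set0; exact: sigma_algebra0.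
  - by rewrite setTD preimage_setC; exact: sigma_algebraC.
  - by move=> hF; rewrite preimage_bigcup; exact: sigma_algebra_bigcup.
have -> : A `*` B = (fst @^-1` A) `&` (snd @^-1` B) by [].
apply: (@measurableI _ (g_sigma_algebraType (@open (D * D)%type))).
  by apply: pre mA => z; exact: cvg_fst.
by apply: pre mB => z; exact: cvg_snd.
Qed.

Fact dual_pull_norm (a : K) xi b : `|xi (a * b)| = 1.
Proof. exact: dual_norm. Qed.
Fact dual_pullD (a : K) xi b c : xi (a * (b + c)) = xi (a * b) * xi (a * c).
Proof. by rewrite mulrDr dualD. Qed.
(* a^* *)
Definition dual_pull (a : K) xi : D :=
  Dual (dual_pull_norm a xi) (@dual_pullD a xi).

Definition dual_act (a : K) (z : D * D) : D * D :=
  (dual_pull a z.1, dual_pull a^-1 z.2).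

Local Open Scope ereal_scope.

(* For countable K the dual is compact and metrizable, so every Borel
   probability measure on it is regular and no regularity needs to be asked. *)
Definition is_haar (m : probability D R) := forall (chi : D) (A : set D),
  measurable A -> m ((fun xi => (chi * xi)%g) @^-1` A) = m A.

Definition act_invariant (mu : probability (D * D)%type R) :=
  forall a : K, a != 0%R -> forall A : set (D * D),
  measurable A -> mu (dual_act a @^-1` A) = mu A.

Definition act_ergodic (mu : probability (D * D)%type R) :=
  forall A : set (D * D), measurable A ->
  (forall a : K, a != 0%R -> dual_act a @^-1` A = A) ->
  mu A = 0 \/ mu A = 1.

End dual_group.

(* Main.v *)
Require Import Defs.
From HB Require Import structures.
From mathcomp Require Import all_boot all_order all_algebra complex.
From mathcomp Require Import all_classical all_reals all_analysis. 
From mathcomp Require Import giry measurable_realfun.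
From mathcomp Require Import ring lra.

Set Implicit Arguments.
Unset Strict Implicit.
Unset Printing Implicit Defensive.

Import Order.TTheory GRing.Theory Num.Theory.

Local Open Scope classical_set_scope.
Local Open Scope ereal_scope.

(** Let phi(x, y) be the integral of xi1(x) * xi2(y) against an invariant
    probability measure mu on the product of two copies of the dual of K.
    Invariance says phi(a x, y / a) = phi(x, y); for a = -1 this gives
    phi = conj phi, so phi is real.  Moreover phi(x, 0) and phi(0, y) do not
    depend on the nonzero x and y, and phi(x, y) = psi(x y) for y nonzero, where
    psi(t) = phi(t, 1).

    Vanishing ([phi_vanish]).  Suppose that phi(x, 0) = 0 for all nonzero x.
    Then the characters xi1(x) are orthonormal in L^2(mu), and Bessel's
    inequality bounds the sum of the psi(t)^2 by 1: psi exceeds any given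
    positive number at finitely many points only.  The characters with indices
    (c x, y / c) all have the same mean r = psi(x y), and two of them have inner
    product psi(- x y (c - d)^2 / (c d)).  The field being infinite, c can be
    chosen successively among n elements so that all these inner products are
    small, since each unwanted value excludes the roots of one nonzero
    polynomial ([exists_spread]).  The Cauchy-Schwarz inequality for the average
    of these n characters makes r^2 arbitrarily small.

    Marginals ([trivial_char_mass]).  If phi(x, 0) = c for all nonzero x, the
    first marginal has the Fourier coefficients of
    (1 - c) haar + c dirac, so it gives mass c to the trivial character, a null
    set for the Haar measure.  The same holds on the second coordinate.

    Consequently an invariant mu that gives mass 0 or 1 to each of the sets
    xi1 = 1 and xi2 = 1 has the same Fourier coefficients as one of the four
    products, hence equals it ([invariant_classification]).  These two sets are
    invariant, so an ergodic measure satisfies the hypothesis.  Conversely, if A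
    is an invariant set of positive measure for one of the four products nu, the
    conditional measure nu( . | A) is invariant and gives the two sets the same
    mass 0 or 1 as nu does; so it equals nu, and nu(A) = 1 ([act_ergodic_prod]).

    Two facts of harmonic analysis carry this.  Fourier coefficients determine a
    probability measure ([fourier_combination]): indicators of half planes are
    bounded pointwise limits of trigonometric polynomials, and half planes
    generate the Borel sets ([dual_measurable_half_plane]).  Characters separate
    the points of K ([dual_separates]), which makes the nontrivial Fourier
    coefficients of the Haar measure vanish ([fourier_haar]). *)

(** * Complex numbers and bounded measurable functions *)

Local Open Scope ring_scope.
Import numFieldNormedType.Exports.
Local Notation Re := complex.Re.
Local Notation Im := complex.Im.
Local Notation conjc := complex.conjc.
Local Open Scope complex_scope.

Lemma addc_Re (R : realType) (z w : R[i]) : Re (z + w) = Re z + Re w.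
Proof. by case: z w => [a b] [c d]. Qed.

Lemma mulc_Re (R : realType) (z w : R[i]) : Re (z * w) = Re z * Re w - Im z * Im w.
Proof. by case: z w => [a b] [c d]. Qed.

Lemma sumc_Re (R : realType) (I : Type) (s : seq I) (F : I -> R[i]) :
  Re (\sum_(i <- s) F i) = \sum_(i <- s) Re (F i).
Proof. exact: (big_morph _ (@addc_Re R) erefl). Qed.

Lemma Re_realM (R : realType) (a : R) (z : R[i]) : Re (a%:C * z) = a * Re z.
Proof. by rewrite mulc_Re /= mul0r subr0. Qed.

Lemma mulconjc_unit (R : realType) (z : R[i]) : `|z| = 1 -> z * conjc z = 1.
Proof. by move=> z1; rewrite -sqr_normc z1 expr1n. Qed.

Lemma normr_Re (R : realType) (z : R[i]) : `|Re z| <= Re `|z|.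
Proof. by rewrite -lecR (RRe_real (normr_real _)) normc_ge_Re. Qed.

Section bounded_measurable.
Context d (T : measurableType d) (R : realType).
Implicit Types f g : T -> R.

Definition bounded_measurable f :=
  measurable_fun setT f /\ exists M, forall t, `|f t| <= M.

Lemma bounded_measurable_integrable (P : probability T R) f :
  bounded_measurable f -> P.-integrable setT (EFin \o f).
Proof.
move=> [mf [M fM]]; apply: measurable_bounded_integrable => //.
  by rewrite (le_lt_trans (probability_le1 P measurableT))// ltry.
exists M; split; first exact: num_real.
by move=> N MN t _ /=; rewrite (le_trans (fM t))// ltW.
Qed.

Lemma bounded_measurable_cst r : bounded_measurable (cst r).
Proof. by split; [exact: measurable_cst|exists `|r| => t]. Qed.

Lemma bounded_measurableD f g : bounded_measurable f -> bounded_measurable g ->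
  bounded_measurable (fun t => f t + g t).
Proof.
move=> [mf [M fM]] [mg [N gN]]; split; first exact: measurable_funD.
by exists (M + N) => t; rewrite (le_trans (ler_normD _ _))// lerD.
Qed.

Lemma bounded_measurableM f g : bounded_measurable f -> bounded_measurable g ->
  bounded_measurable (fun t => f t * g t).
Proof.
move=> [mf [M fM]] [mg [N gN]]; split; first exact: measurable_funM.
by exists (M * N) => t; rewrite normrM ler_pM.
Qed.

Lemma bounded_measurable_sum (I : Type) (s : seq I) (F : I -> T -> R) :
  (forall i, bounded_measurable (F i)) ->
  bounded_measurable (fun t => \sum_(i <- s) F i t).
Proof.
move=> bF; elim: s => [|i s IH].
  under eq_fun do rewrite big_nil; exact: bounded_measurable_cst.
by under eq_fun do rewrite big_cons; apply: bounded_measurableD.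
Qed.

Lemma Rintegral_sum (P : probability T R) (I : Type) (s : seq I)
    (F : I -> T -> R) : (forall i, bounded_measurable (F i)) ->
  \int[P]_t (\sum_(i <- s) F i t) = \sum_(i <- s) \int[P]_t F i t.
Proof.
move=> bF; elim: s => [|i s IH].
  under eq_Rintegral do rewrite big_nil.
  by rewrite Rintegral_cst// mul0r big_nil.
under eq_Rintegral do rewrite big_cons.
rewrite big_cons -IH RintegralD//; apply: bounded_measurable_integrable => //.
exact: bounded_measurable_sum.
Qed.

End bounded_measurable.

Lemma Rintegral_linear_bounded d (T : measurableType d) (R : realType)
    (P : probability T R) (a b : R) (f g : T -> R) :
  bounded_measurable f -> bounded_measurable g ->
  \int[P]_t (a * f t + b * g t) = a * \int[P]_t f t + b * \int[P]_t g t.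
Proof.
move=> bf bg; rewrite RintegralD//; last 2 first.
- by apply: bounded_measurable_integrable; apply: bounded_measurableM => //;
    exact: bounded_measurable_cst.
- by apply: bounded_measurable_integrable; apply: bounded_measurableM => //;
    exact: bounded_measurable_cst.
by rewrite !RintegralZl//; exact: bounded_measurable_integrable.
Qed.

(** * Trigonometric polynomials *)

Section characters.
Context (R : realType) d (T : measurableType d) (G : zmodType).

(** Measurability of Re (w * e g) for all w covers the real part (w = 1) and the
    imaginary part (w = - i) of e g together. *)
Record character_family (e : G -> T -> R[i]) : Prop := {
  char_norm : forall g t, `|e g t| = 1;
  charD : forall g h t, e (g + h) t = e g t * e h t;
  measurable_char : forall g w, measurable_fun setT (fun t => Re (w * e g t))
}.

Variables (e : G -> T -> R[i]) (ce : character_family e).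

Lemma char0 t : e 0 t = 1.
Proof.
have e0 : e 0 t != 0 by rewrite -normr_eq0 (char_norm ce) oner_eq0.
by apply: (mulfI e0); rewrite -(charD ce) addr0 mulr1.
Qed.

Lemma charN g t : e (- g) t = conjc (e g t).
Proof.
rewrite -[LHS]mulr1 -(mulconjc_unit (char_norm ce g t)) mulrA -(charD ce).
by rewrite addNr char0 mul1r.
Qed.

Lemma bounded_measurable_char g w :
  bounded_measurable (fun t => Re (w * e g t)).
Proof.
split; first exact: measurable_char.
exists (Re `|w|) => t; apply: (le_trans (normr_Re _)).
by rewrite normrM (char_norm ce) mulr1.
Qed.

Definition trig_poly (f : T -> R) := exists s : seq (R[i] * G),
  f = fun t => Re (\sum_(u <- s) u.1 * e u.2 t).

Lemma trig_poly_char w g : trig_poly (fun t => Re (w * e g t)).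
Proof. by exists [:: (w, g)]; apply/funext => t; rewrite big_seq1. Qed.

Lemma trig_poly_cst (r : R) : trig_poly (cst r).
Proof.
by exists [:: (r%:C, 0)]; apply/funext => t; rewrite big_seq1 char0 mulr1.
Qed.

Lemma trig_polyD f g : trig_poly f -> trig_poly g ->
  trig_poly (fun t => f t + g t).
Proof.
move=> [s ->] [s' ->]; exists (s ++ s').
by apply/funext => t; rewrite big_cat addc_Re.
Qed.

(** The first factor is replaced by a complex combination with real values,
    Re z = (z + conj z) / 2, where conj (e g) = e (- g): the product of the
    combinations then has the product of the real parts as its real part. *)
Lemma trig_polyM f g : trig_poly f -> trig_poly g ->
  trig_poly (fun t => f t * g t).
Proof.
move=> [s ->] [s' ->].
pose r := [seq (2^-1 * u.1, u.2) | u <- s] ++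
          [seq (2^-1 * conjc u.1, - u.2) | u <- s].
exists [seq (u.1 * v.1, u.2 + v.2) | u <- r, v <- s'].
apply/funext => t; rewrite big_allpairs_dep /=.
transitivity (Re ((\sum_(u <- r) u.1 * e u.2 t) * (\sum_(v <- s') v.1 * e v.2 t))).
  have -> : \sum_(u <- r) u.1 * e u.2 t = (Re (\sum_(u <- s) u.1 * e u.2 t))%:C.
    rewrite ReJ_add raddf_sum /= mulrDl !mulr_suml /r big_cat/= !big_map/=.
    congr (_ + _); apply: eq_bigr => u _; first by rewrite [RHS]mulrC mulrA.
    by rewrite charN rmorphM/= [in RHS]mulrC mulrA.
  by rewrite Re_realM.
congr Re; rewrite mulr_suml; apply: eq_bigr => u _.
by rewrite mulr_sumr; apply: eq_bigr => v _; rewrite (charD ce) mulrACA.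
Qed.

Lemma bounded_measurable_trig f : trig_poly f -> bounded_measurable f.
Proof.
move=> [s ->]; under eq_fun do rewrite sumc_Re.
by apply: bounded_measurable_sum => u; exact: bounded_measurable_char.
Qed.

Definition fourier (P : probability T R) (g : G) : R[i] :=
  (\int[P]_t Re (e g t)) +i* (\int[P]_t Im (e g t)).

(** Reduces statements on imaginary parts to those on real parts. *)
Lemma Im_ReN (z : R[i]) : Im z = Re ((0 -i* 1) * z).
Proof. case: z => a b; rewrite mulc_Re /=; ring. Qed.

Lemma Rintegral_char (P : probability T R) w g :
  \int[P]_t Re (w * e g t) = Re (w * fourier P g).
Proof.
have bR : bounded_measurable (fun t => Re (e g t)).
  by under eq_fun do rewrite -[e g _]mul1r; exact: bounded_measurable_char.
have bI : bounded_measurable (fun t => Im (e g t)).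
  by under eq_fun do rewrite Im_ReN; exact: bounded_measurable_char.
under eq_Rintegral do rewrite mulc_Re -mulNr.
by rewrite Rintegral_linear_bounded// mulc_Re /= mulNr.
Qed.

Lemma Rintegral_trig (P : probability T R) (s : seq (R[i] * G)) :
  \int[P]_t Re (\sum_(u <- s) u.1 * e u.2 t) =
  Re (\sum_(u <- s) u.1 * fourier P u.2).
Proof.
under eq_Rintegral do rewrite sumc_Re.
rewrite Rintegral_sum => [|u]; last exact: bounded_measurable_char.
by rewrite sumc_Re; apply: eq_bigr => u _; rewrite Rintegral_char.
Qed.

Lemma fourier_dirac (t : T) g : fourier (dirac t) g = e g t.
Proof.
have E w : \int[dirac t]_x Re (w * e g x) = Re (w * e g t).
  rewrite /Rintegral integral_dirac//; last exact/measurable_EFinP/measurable_char.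
  by rewrite diracT mul1e.
rewrite /fourier.
under eq_Rintegral do rewrite -[e g _]mul1r.
under [X in _ +i* X]eq_Rintegral do rewrite Im_ReN.
by rewrite !E -Im_ReN mul1r; case: (e g t).
Qed.

Lemma Rintegral_prob_cst (P : probability T R) r : \int[P]_t r = r.
Proof.
rewrite Rintegral_cst// (_ : fine _ = 1) ?mulr1//.
exact: (congr1 fine (probability_setT P)).
Qed.

Lemma fourier0 (P : probability T R) : fourier P 0 = 1.
Proof.
rewrite /fourier; under eq_Rintegral do rewrite char0.
under [X in _ +i* X]eq_Rintegral do rewrite char0.
by rewrite !Rintegral_prob_cst.
Qed.

(** The cubic that fixes -1, 0 and 1 and attracts the rest of [-1, 1] to -1 or 1.
    Being a polynomial, its iterates turn trigonometric polynomials into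
    trigonometric polynomials that converge to a sign. *)
Definition smoothstep (u : R) : R := 3 / 2 * u - u ^+ 3 / 2.

(** The third bound comes from 1 - smoothstep u = (1 - u)^2 (2 + u) / 2; it
    makes the convergence of the iterates geometric. *)
Lemma smoothstep_itv u : 0 < u <= 1 ->
  [/\ u <= smoothstep u, smoothstep u <= 1 &
      1 - smoothstep u <= (1 - u) * (1 - u / 2)].
Proof.
rewrite /smoothstep => /andP[u0 u1]; split; rewrite -subr_ge0.
- rewrite (_ : _ - _ = u * (1 - u) * (1 + u) / 2); last by field.
  by rewrite !mulr_ge0//; lra.
- rewrite (_ : _ - _ = (1 - u) ^+ 2 * (2 + u) / 2); last by field.
  by rewrite !mulr_ge0// ?sqr_ge0//; lra.
- rewrite (_ : _ - _ = u ^+ 2 * (1 - u) / 2); last by field.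
  by rewrite !mulr_ge0// ?sqr_ge0//; lra.
Qed.

Lemma iter_smoothstep u n : 0 < u <= 1 ->
  [/\ u <= iter n smoothstep u, iter n smoothstep u <= 1 &
      1 - iter n smoothstep u <= (1 - u / 2) ^+ n].
Proof.
move=> /andP[u0 u1]; elim: n => [|n [h1 h2 h3]].
  by rewrite /= lexx u1 expr0; split => //; lra.
have hn : 0 < iter n smoothstep u <= 1 by rewrite h2 (lt_le_trans u0).
have [k1 k2 k3] := smoothstep_itv hn; rewrite iterS; split => //.
  exact: le_trans h1 k1.
apply: (le_trans k3); rewrite exprSr; apply: ler_pM; lra.
Qed.

Lemma smoothstepN u : smoothstep (- u) = - smoothstep u.
Proof. by rewrite /smoothstep; field. Qed.

Lemma iter_smoothstepN n u : iter n smoothstep (- u) = - iter n smoothstep u.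
Proof. by elim: n => //= n ->; rewrite smoothstepN. Qed.

Lemma iter_smoothstep0 n : iter n smoothstep 0 = 0.
Proof. by elim: n => //= n ->; rewrite /smoothstep; ring. Qed.

Lemma iter_smoothstep_norm u n : `|u| <= 1 -> `|iter n smoothstep u| <= 1.
Proof.
have pos v : 0 < v <= 1 -> `|iter n smoothstep v| <= 1.
  move=> /[dup] /andP[v0 _] /(iter_smoothstep n)[h1 h2 _].
  by rewrite ger0_norm// (le_trans (ltW v0)).
rewrite ler_norml => /andP[u1 u2]; have [u0|u0|->] := ltgtP u 0.
- by rewrite -normrN -iter_smoothstepN; apply: pos; lra.
- by apply: pos; rewrite u0.
- by rewrite iter_smoothstep0 normr0.
Qed.

Lemma cvg_iter_smoothstep u : `|u| <= 1 ->
  (fun n => iter n smoothstep u) @ \oo --> Num.sg u.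
Proof.
have pos v : 0 < v <= 1 -> (fun n => iter n smoothstep v) @ \oo --> (1 : R).
  move=> /[dup] v01 /andP[v0 v1].
  have : (fun n => 1 - geometric 1 (1 - v / 2) n) @ \oo --> (1 - 0 : R).
    apply: cvgB; [exact: cvg_cst|apply: cvg_geometric].
    by rewrite ger0_norm; lra.
  rewrite subr0 => /(squeeze_cvgr _); apply; last exact: cvg_cst.
  apply: nearW => n; have [_ h2 h3] := iter_smoothstep n v01.
  by rewrite h2 andbT /= mul1r; lra.
rewrite ler_norml => /andP[u1 u2]; have [u0|u0|->] := ltgtP u 0.
- have -> : (fun n => iter n smoothstep u) = fun n => - iter n smoothstep (- u).
    by apply/funext => n; rewrite iter_smoothstepN opprK.
  by rewrite ltr0_sg//; apply: cvgN; apply: pos; lra.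
- by rewrite gtr0_sg//; apply: pos; rewrite u0.
- rewrite sgr0; under eq_fun do rewrite iter_smoothstep0.
  exact: cvg_cst.
Qed.
End characters.
Arguments smoothstep {R} u.
Arguments cvg_iter_smoothstep {R u}.
Arguments iter_smoothstep_norm {R u}.

(** * Fourier coefficients determine the measure *)

Section bounded_convergence.
Context (R : realType) d (T : measurableType d).

Lemma cvg_Rintegral_bounded (P : probability T R) (f_ : (T -> R)^nat) (f : T -> R) :
  (forall n, measurable_fun setT (f_ n)) -> (forall n t, `|f_ n t| <= 1) ->
  (forall t, f_ ^~ t @ \oo --> f t) ->
  (fun n => \int[P]_t f_ n t) @ \oo --> \int[P]_t f t.
Proof.
move=> mf_ f_1 f_f.
have mf : measurable_fun setT f by exact: (measurable_fun_cvg mf_).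
have i1 : P.-integrable setT (cst 1%:E : T -> \bar R).
  exact: (bounded_measurable_integrable _ (bounded_measurable_cst T 1)).
have [] := @dominated_convergence _ T R P setT measurableT
  (fun n => EFin \o f_ n) (EFin \o f) (cst 1%:E).
- by move=> n; exact/measurable_EFinP.
- exact/measurable_EFinP.
- by apply: aeW => t _; apply: cvg_EFin; [exact: nearW|exact: f_f].
- exact: i1.
- by apply: aeW => t n _; rewrite lee_fin.
move=> intf _ cf; apply: fine_cvg; rewrite fineK//.
exact: integrable_fin_num intf.
Qed.

Lemma Rintegral_indic (P : probability T R) (U : set T) : measurable U ->
  \int[P]_t \1_U t = fine (P U).
Proof. by move=> mU; rewrite /Rintegral integral_indic// setIT. Qed.

Lemma cvg_combination (I : Type) (s : seq I) (a : I -> R) (u : I -> R^nat) (l : I -> R) :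
  (forall i, u i @ \oo --> l i) ->
  (fun n => \sum_(i <- s) a i * u i n) @ \oo --> \sum_(i <- s) a i * l i.
Proof.
move=> ul; elim: s => [|i s IH].
  by under eq_fun do rewrite big_nil; rewrite big_nil; exact: cvg_cst.
under eq_fun do rewrite big_cons; rewrite big_cons.
by apply: cvgD => //; apply: cvgM => //; exact: cvg_cst.
Qed.

Lemma cvg_cst_eq (u : R^nat) (a l : R) : (forall n, u n = a) -> u @ \oo --> l -> l = a.
Proof.
move=> ua ul; have ua' : u @ \oo --> a.
  by rewrite (_ : u = cst a); [exact: cvg_cst|apply/funext].
exact: (cvg_unique _ ul ua').
Qed.

End bounded_convergence.

Section uniqueness.
Context (R : realType) d (T : measurableType d) (G : zmodType).
Variables (e : G -> T -> R[i]) (ce : character_family e).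

(** The sets to which an equality of integrals of trigonometric polynomials
    passes by bounded convergence.  The bound 1 is preserved by products, which
    makes these sets a pi-system. *)
Definition trig_limit : set (set T) := [set U | exists f_ : (T -> R)^nat,
  [/\ forall n, trig_poly e (f_ n), forall n t, `|f_ n t| <= 1 &
      forall t, f_ ^~ t @ \oo --> (\1_U t : R)]].

Lemma trig_limit_setI : setI_closed trig_limit.
Proof.
move=> U V [f_ [tf f1 fU]] [g_ [tg g1 gV]].
exists (fun n t => f_ n t * g_ n t); split.
- by move=> n; exact: trig_polyM.
- by move=> n t; rewrite normrM mulr_ile1.
- by move=> t; rewrite indicI; exact: cvgM.
Qed.

Lemma trig_limit_measurable U : trig_limit U -> measurable U.
Proof.
move=> [f_ [tf f1 fU]]; apply/(@measurable_indicP _ _ R).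
apply: (@measurable_fun_cvg _ _ _ _ f_) => [n|t _]; last exact: fU.
by have [] := bounded_measurable_trig ce (tf n).
Qed.

Definition half_plane : set (set T) :=
  [set U | exists g w r, U = [set t | r < Re (w * e g t)]].

Lemma trig_poly_smoothstep f n :
  trig_poly e f -> trig_poly e (fun t => iter n smoothstep (f t)).
Proof.
move=> tf; elim: n => // n IH.
rewrite (_ : (fun _ => _) = fun t =>
    3 / 2 * iter n smoothstep (f t) +
    - 2^-1 * (iter n smoothstep (f t) *
              (iter n smoothstep (f t) * iter n smoothstep (f t)))); last first.
  by apply/funext => t; rewrite iterS [LHS]/smoothstep; field.
by apply: trig_polyD; repeat (apply: trig_polyM => //); exact: trig_poly_cst.
Qed.

(** Let u be Re (w * e g) - r scaled into [-1, 1] and S n the n-th iterate of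
    smoothstep at u.  Then S n tends to the sign of u, and S n (1 + S n) / 2 tends
    to 1 where u > 0 and to 0 elsewhere, including where u = 0. *)
Lemma half_plane_trig_limit : half_plane `<=` trig_limit.
Proof.
move=> _ [g [w [r ->]]].
pose M := Re `|w| + `|r| + 1.
have w0 : 0 <= Re `|w| by rewrite (le_trans _ (normr_Re w)).
have M0 : 0 < M by have := normr_ge0 r; rewrite /M; lra.
pose u t := M^-1 * (Re (w * e g t) + - r).
have u1 t : `|u t| <= 1.
  rewrite normrM ger0_norm ?invr_ge0 ?(ltW M0)// ler_pdivrMl// mulr1.
  rewrite (le_trans (ler_normD _ _))// normrN /M.
  have := normr_Re (w * e g t); rewrite normrM (char_norm ce) mulr1.
  by move: (`|r|) (`|Re (w * _)|) => a b; lra.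
have tu : trig_poly e u.
  apply: trig_polyM => //; first exact: trig_poly_cst.
  by apply: trig_polyD; [exact: trig_poly_char|exact: trig_poly_cst].
pose S n t := iter n smoothstep (u t).
have tS n : trig_poly e (S n) by exact: trig_poly_smoothstep.
exists (fun n t => 2^-1 * (S n t * (1 + S n t))); split => [n|n t|t].
- apply: trig_polyM => //; first exact: trig_poly_cst.
  by apply: trig_polyM => //; apply: trig_polyD => //; exact: trig_poly_cst.
- have := iter_smoothstep_norm n (u1 t); rewrite -/(S n t) !ler_norml.
  by move: (S n t) => x /andP[x1 x2]; nra.
- rewrite indicE (_ : (t \in _) = (0 < u t)%R); last first.
    by rewrite /u pmulr_rgt0 ?invr_gt0// subr_gt0; apply/idP/idP; rewrite inE.
  have -> : ((0 < u t)%R)%:R = 2^-1 * (Num.sg (u t) * (1 + Num.sg (u t))) :> R.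
    by case: sgrP => _ /=; field.
  have := cvg_iter_smoothstep (u1 t) => cS.
  apply: cvgM; first exact: cvg_cst.
  by apply: cvgM => //; apply: cvgD => //; exact: cvg_cst.
Qed.

(** Stated for signed combinations of measures, it gives uniqueness (weights 1
    and -1), and it also evaluates a mass when the coefficients of a measure are
    a combination of known ones, whatever the signs of the weights.  The sets for
    which the conclusion holds form a lambda-system that contains the pi-system
    trig_limit. *)
Lemma fourier_combination (s : seq (R * probability T R)) :
  (forall g, \sum_(v <- s) v.1%:C * fourier e v.2 g = 0) ->
  forall U, <<s half_plane >> U -> \sum_(v <- s) v.1 * fine (v.2 U) = 0.
Proof.
move=> s0.
have trig0 f : trig_poly e f -> \sum_(v <- s) v.1 * \int[v.2]_t f t = 0.
  move=> [r ->]; under eq_bigr do rewrite Rintegral_trig// -Re_realM mulr_sumr.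
  rewrite -sumc_Re exchange_big/= big1// => u _.
  under eq_bigr do rewrite mulrCA.
  by rewrite -mulr_sumr s0 mulr0.
pose D := [set U | measurable U /\ \sum_(v <- s) v.1 * fine (v.2 U) = 0].
have cD (f_ : (T -> R)^nat) U : measurable U ->
    (forall n, measurable_fun setT (f_ n)) -> (forall n t, `|f_ n t| <= 1) ->
    (forall t, f_ ^~ t @ \oo --> (\1_U t : R)) ->
    (forall n, \sum_(v <- s) v.1 * \int[v.2]_t f_ n t = 0) -> D U.
  move=> mU mf f1 fU L0; split => //.
  under eq_bigr do rewrite -Rintegral_indic//.
  apply: (cvg_cst_eq L0).
  apply: (@cvg_combination _ _ s (fun v => v.1)
    (fun v n => \int[v.2]_t f_ n t) (fun v => \int[v.2]_t \1_U t)) => v.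
  exact: cvg_Rintegral_bounded.
(* closure under increasing unions and limits of trigonometric polynomials are
   two instances of cD *)
suff sD : <<s trig_limit >> `<=` D.
  move=> U hU; have [] // := sD U.
  move: hU; apply: smallest_sub; first exact: smallest_sigma_algebra.
  by move=> V /half_plane_trig_limit; exact: sub_sigma_algebra.
apply: lambda_system_subset; [exact: trig_limit_setI| | |by []].
- split => //.
  + split => //; have := trig0 _ (trig_poly_cst ce 1).
    under eq_bigr do rewrite (Rintegral_prob_cst _ 1) mulr1.
    by under [in X in _ -> X]eq_bigr do rewrite (congr1 fine (probability_setT _)) mulr1.
  + move=> A B BA [mA A0] [mB B0]; split; first exact: measurableD.
    transitivity (\sum_(v <- s) v.1 * fine (v.2 A) - \sum_(v <- s) v.1 * fine (v.2 B)).
      rewrite -sumrB; apply: eq_bigr => v _; rewrite -mulrBr; congr (_ * _).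
      rewrite measureD//; last by rewrite ltey_eq fin_num_measure.
      by rewrite setIidr// fineB// fin_num_measure.
    by rewrite A0 B0 subr0.
  + move=> F ndF FD; apply: (cD (fun n => \1_(F n))).
    * by apply: bigcup_measurable => k _; have [] := FD k.
    * by move=> n; apply/measurable_indicP; have [] := FD n.
    * by move=> n t; rewrite indicE; case: (t \in F n); rewrite /= ?normr1 ?normr0.
    * move=> t; apply: cvg_near_cst.
      have [Ft|Ft] := pselect ((\bigcup_i F i) t).
        case: Ft => k _ Fkt; exists k => // n /= kn.
        rewrite !indicE !mem_set//; first by exists k.
        by have /subsetPset := ndF _ _ kn; exact.
      apply: nearW => n; rewrite !indicE (memNset Ft) memNset// => Fnt.
      by apply: Ft; exists n.
    * move=> n; have [mFn Fn0] := FD n; rewrite -[RHS]Fn0.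
      by apply: eq_bigr => v _; rewrite Rintegral_indic.
- move=> U /[dup] /trig_limit_measurable mU [f_ [tf f1 fU]].
  apply: (cD f_) => // n; last exact: trig0.
  by have [] := bounded_measurable_trig ce (tf n).
Qed.

Lemma half_plane_sigma_measurable U : <<s half_plane >> U -> measurable U.
Proof.
apply: smallest_sub; first exact: sigma_algebra_measurable.
by move=> V /half_plane_trig_limit/trig_limit_measurable.
Qed.

Lemma fourier_inj (P Q : probability T R) : (forall g, fourier e P g = fourier e Q g) ->
  forall U, <<s half_plane >> U -> P U = Q U.
Proof.
move=> PQ U hU.
have mU := half_plane_sigma_measurable hU.
have := @fourier_combination [:: (1, P); (-1, Q)] _ _ hU.
rewrite !big_cons big_nil /= addr0 mul1r mulN1r => PQU.
apply/eqP; rewrite -(fineK (fin_num_measure P _ mU)) -(fineK (fin_num_measure Q _ mU)).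
rewrite eqe -subr_eq0; apply/eqP; apply: PQU => g.
by rewrite !big_cons big_nil /= PQ; ring.
Qed.

End uniqueness.

(** * Consequences of positivity *)

Lemma sum_eq_uniq (R : pzRingType) (I : eqType) (s : seq I) (i : I) (c : I -> R) :
  uniq s -> i \in s -> \sum_(j <- s) (if i == j then c j else 0) = c i.
Proof.
move=> us si; rewrite -big_mkcond/= -big_filter.
rewrite (_ : [seq j <- s | i == j] = [:: i]) ?big_seq1//.
by rewrite -(filter_pred1_uniq us si); apply: eq_filter => j /=; rewrite eq_sym.
Qed.

Section positivity.
Context (R : realType) d (T : measurableType d) (G : zmodType).
Variables (e : G -> T -> R[i]) (ce : character_family e).
Variable P : probability T R.
Local Notation phi g := (Re (fourier e P g)).

(** The right-hand side is the squared modulus of the complex sum. *)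
Lemma sqr_Re_le_gram (I : Type) (s : seq I) (c : I -> R) (p : I -> G) t :
  Re (\sum_(i <- s) (c i)%:C * e (p i) t) ^+ 2 <=
  \sum_(i <- s) \sum_(j <- s) c i * c j * Re (e (p i - p j) t).
Proof.
pose z := \sum_(i <- s) (c i)%:C * e (p i) t; rewrite -/z.
rewrite [leRHS](_ : _ = Re (z * conjc z)).
  by case: z => a b; rewrite mulc_Re /= mulrN opprK -!expr2 lerDl sqr_ge0.
rewrite /z rmorph_sum mulr_suml sumc_Re; apply: eq_bigr => i _.
rewrite mulr_sumr sumc_Re; apply: eq_bigr => j _.
rewrite -Re_realM (charD ce) charN// rmorphM rmorphM/=.
by rewrite oppr0 mulrACA.
Qed.

Lemma Rintegral_gram (I : Type) (s : seq I) (c : I -> R) (p : I -> G) :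
  bounded_measurable
    (fun t => \sum_(i <- s) \sum_(j <- s) c i * c j * Re (e (p i - p j) t)) /\
  \int[P]_t (\sum_(i <- s) \sum_(j <- s) c i * c j * Re (e (p i - p j) t)) =
  \sum_(i <- s) \sum_(j <- s) c i * c j * phi (p i - p j).
Proof.
have bc i j : bounded_measurable (fun t => c i * c j * Re (e (p i - p j) t)).
  by under eq_fun do rewrite -Re_realM; exact: bounded_measurable_char.
split; first by do 2 (apply: bounded_measurable_sum => ?).
rewrite Rintegral_sum => [|i]; last exact: bounded_measurable_sum.
apply: eq_bigr => i _; rewrite Rintegral_sum//; apply: eq_bigr => j _.
by under eq_Rintegral do rewrite -Re_realM; rewrite Rintegral_char// Re_realM.
Qed.

(** Positive definiteness in Cauchy-Schwarz form: the square of the mean of a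
    combination of characters is at most the mean of its squared modulus. *)
Lemma fourier_gram (I : Type) (s : seq I) (c : I -> R) (p : I -> G) :
  (\sum_(i <- s) c i * phi (p i)) ^+ 2 <=
  \sum_(i <- s) \sum_(j <- s) c i * c j * phi (p i - p j).
Proof.
have [bH <-] := Rintegral_gram s c p.
set H := (fun t => _) in bH; pose r := [seq ((c i)%:C, p i) | i <- s].
pose f t := Re (\sum_(i <- s) (c i)%:C * e (p i) t).
have fE : f = fun t => Re (\sum_(u <- r) u.1 * e u.2 t).
  by apply/funext => t; rewrite /f /r big_map.
have bf : bounded_measurable f by rewrite fE; apply: (bounded_measurable_trig ce); exists r.
set m := \sum_(i <- s) _.
have fm : \int[P]_t f t = m.
  rewrite fE Rintegral_trig// /r big_map sumc_Re.
  by apply: eq_bigr => i _; rewrite Re_realM.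
(* f^2 <= H and (f - m)^2 >= 0 give - m^2 <= H - 2 m f pointwise *)
suff : - m ^+ 2 <= \int[P]_t (1 * H t + (- (2 * m)) * f t).
  by rewrite Rintegral_linear_bounded// fm; move: (\int[P]_t _) => h; nra.
rewrite -[leLHS](Rintegral_prob_cst P).
apply: le_Rintegral => //.
- by apply: bounded_measurable_integrable; exact: bounded_measurable_cst.
- apply: bounded_measurable_integrable.
  by apply: bounded_measurableD; apply: bounded_measurableM => //;
    exact: bounded_measurable_cst.
move=> t _; rewrite mul1r; have : f t ^+ 2 <= H t := sqr_Re_le_gram s c p t.
by have := sqr_ge0 (f t - m); move: (f t) (H t) => a b; nra.
Qed.

(** Bessel's inequality for the constant 1 and the orthonormal characters of s:
    fourier_gram with weight phi g on g reads S^2 <= S for the sum S. *)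
Lemma fourier_bessel (s : seq G) : uniq s ->
  {in s &, forall g h, g != h -> phi (g - h) = 0} ->
  \sum_(g <- s) phi g ^+ 2 <= 1.
Proof.
move=> us s0; have := @fourier_gram _ s (fun g => phi g) id.
set S := \sum_(g <- s) _ ^+ 2.
rewrite [leRHS](_ : _ = S); last first.
  rewrite big_seq [RHS]big_seq; apply: eq_bigr => g gs.
  rewrite -[RHS](@sum_eq_uniq _ _ s g (fun g => phi g ^+ 2))// big_seq [RHS]big_seq.
  apply: eq_bigr => h hs; case: eqVneq => [<-|gh].
    by rewrite subrr (fourier0 ce) mulr1.
  by rewrite s0// mulr0.
have : 0 <= S by apply: sumr_ge0 => g _; exact: sqr_ge0.
by move: S => S; nra.
Qed.

Lemma gram_sum_le (s : seq G) (ep : R) : uniq s -> 0 <= ep ->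
  {in s &, forall g h, g != h -> phi (g - h) <= ep} ->
  \sum_(g <- s) \sum_(h <- s) 1 * 1 * phi (g - h) <=
    (size s)%:R + (size s)%:R ^+ 2 * ep.
Proof.
move=> us e0 sep.
have -> : (size s)%:R + (size s)%:R ^+ 2 * ep =
    \sum_(g <- s) \sum_(h <- s) ((if g == h then 1 else 0) + ep).
  under eq_bigr do rewrite big_split/=.
  rewrite big_split/= [in RHS]big_seq.
  under [in RHS]eq_bigr => g gs do rewrite (sum_eq_uniq (fun=> 1))//.
  rewrite -big_seq !big_const_seq !count_predT !iter_addr_0.
  by rewrite -mulrnA -[_ *+ (_ * _)]mulr_natl natrM expr2.
rewrite big_seq [leRHS]big_seq; apply: ler_sum => g gs.
rewrite big_seq [leRHS]big_seq; apply: ler_sum => h hs.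
rewrite !mul1r; case: eqVneq => [<-|gh]; last by rewrite add0r sep.
by rewrite subrr (fourier0 ce) lerDl.
Qed.

(** Cauchy-Schwarz for the average of the characters of s, that is, fourier_gram
    with equal weights. *)
Lemma fourier_almost_orthogonal (s : seq G) (ep r : R) : uniq s -> 0 <= ep ->
  {in s &, forall g h, g != h -> phi (g - h) <= ep} ->
  {in s, forall g, phi g = r} ->
  (0 < size s)%N -> r ^+ 2 <= (size s)%:R^-1 + ep.
Proof.
move=> us e0 sep sr s0; have := @fourier_gram _ s (fun=> 1) id.
move=> /le_trans /(_ (gram_sum_le us e0 sep)).
rewrite (_ : \sum_(i <- s) _ = (size s)%:R * r); last first.
  rewrite big_seq; under eq_bigr => g gs do rewrite mul1r sr//.
  by rewrite -big_seq big_const_seq count_predT iter_addr_0 mulr_natl.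
have n0 : 0 < (size s)%:R :> R by rewrite ltr0n.
rewrite exprMn -ler_pdivlMl ?exprn_gt0// => /le_trans; apply.
by rewrite mulrDr mulKf ?expf_neq0 ?gt_eqF// expr2 invfM -mulrA mulVf ?gt_eqF// mulr1.
Qed.

(** Where all characters equal 1, a sum of n of them is n, whereas its mean
    square is n by orthogonality: the mass is at most 1 / n. *)
Lemma trivial_char_null : infinite_set [set: G] ->
  (forall g, g != 0 -> phi g = 0) ->
  measurable [set t | forall g, e g t = 1] -> P [set t | forall g, e g t = 1] = 0%E.
Proof.
move=> Ginf phi0; set E := (X in measurable X) => mE.
have [//|PE0] := eqVneq (P E) 0%E.
have PE : 0 < fine (P E).
  by rewrite fine_gt0// lt0e PE0 measure_ge0 ltey_eq fin_num_measure.
have [B _ nB] := infinite_set_fset (Num.trunc (fine (P E))^-1).+1 Ginf.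
move: (finmap.fset_uniq B) nB; set s := finmap.enum_fset B => us nB.
have [bH HE] := Rintegral_gram s (fun=> 1) id.
have s0 : {in s &, forall g h, g != h -> phi (g - h) <= 0}.
  by move=> g h _ _ gh; rewrite phi0// subr_eq0.
have : (size s)%:R ^+ 2 * fine (P E) <= (size s)%:R.
  have := gram_sum_le us (lexx 0) s0; rewrite mulr0 addr0; apply: le_trans.
  have bE : bounded_measurable (\1_E : T -> R).
    split; first exact/measurable_indicP.
    by exists 1 => t; rewrite indicE; case: (t \in E); rewrite ?normr1 ?normr0.
  rewrite -HE -Rintegral_indic// -RintegralZl//; last exact: bounded_measurable_integrable.
  apply: le_Rintegral => //; [|exact: bounded_measurable_integrable|].
    by apply: bounded_measurable_integrable; apply: bounded_measurableM => //;
      exact: bounded_measurable_cst.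
  move=> t _; have := sqr_Re_le_gram s (fun=> 1) id t; apply: le_trans.
  rewrite indicE; have [tE|tE] := boolP (t \in E); last by rewrite mulr0 sqr_ge0.
  rewrite mulr1 sumc_Re; under eq_bigr => g _ do rewrite (set_mem tE) mulr1.
  by rewrite big_const_seq count_predT iter_addr_0.
have n0 : 0 < (size s)%:R :> R by rewrite ltr0n (leq_trans _ nB).
rewrite expr2 -mulrA -[leRHS]mulr1 ler_pM2l// => {}HE.
have := truncnS_gt (fine (P E))^-1; rewrite invf_plt ?posrE// ltNge.
suff -> : fine (P E) <= (Num.trunc (fine (P E))^-1).+1%:R^-1 by [].
rewrite -ler_pdivlMl// mulr1 in HE; apply: (le_trans HE).
by rewrite lef_pV2 ?posrE ?ltr0n// ?ler_nat// (leq_trans _ nB).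
Qed.

End positivity.

(** * Borel sets of the dual *)

Section dual_characters.
Context (R : realType) (K : fieldType).
Local Notation D := (pdual R K).

(** Takes its arguments in the order required by character_family. *)
Definition ev (b : K) (xi : D) : R[i] := xi b.

Lemma open_half_plane (w : R[i]) (r : R) :
  open ([set z : R[i] | r < Re (w * z)] : set R[i]^o).
Proof.
rewrite openE => z /= rz.
pose M := Re `|w| + 1.
have M0 : 0 < M by have := le_trans (normr_ge0 _) (normr_Re w); rewrite /M; lra.
exists ((Re (w * z) - r) / M)%:C => /=.
  by rewrite ltcR divr_gt0// subr_gt0.
move=> y /= zy; have -> : Re (w * y) = Re (w * z) - Re (w * (z - y)).
  by rewrite mulrBr !mulc_Re /=; case: (w) (z) (y) => [a b] [c d'] [e f] /=; ring.
have h : Re (w * (z - y)) <= Re `|w| * Re `|z - y|.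
  rewrite (le_trans (ler_norm _))// (le_trans (normr_Re _))// normrM mulc_Re.
  by rewrite (_ : Im `|w| = 0) ?mul0r ?subr0// ger0_Im.
move: zy; rewrite -[X in X < _](RRe_real (normr_real _)) ltcR ltr_pdivlMr//.
have := le_trans (normr_ge0 _) (normr_Re w).
have := le_trans (normr_ge0 _) (normr_Re (z - y)).
move: h; rewrite /M; move: (Re `|w|) (Re `|z - y|) (Re _) (Re _) => a b c d'.
nra.
Qed.

Lemma ev_family : character_family ev.
Proof.
split => [b xi|b c xi|b w]; [exact: dual_norm|exact: dualD|].
apply: (measurability _ (RGenOInfty.measurableE R)) => _ [_ [r ->] <-].
rewrite setTI; apply: sub_sigma_algebra.
rewrite (_ : _ @^-1` _ = (fun xi : D => xi b : R[i]^o) @^-1` [set z | r < Re (w * z)]).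
  by have /continuousP := @Defs.eval_continuous R K b; apply; exact: open_half_plane.
by apply/seteqP; split => xi /=; rewrite in_itv/= andbT.
Qed.

(** The powers of i give bounds on both sides for the real and the imaginary
    part; rational bounds keep the family countable. *)
Definition box_half (j : K * nat * rat) : set D :=
  [set xi | ratr j.2 < Re ('i%C ^+ j.1.2 * xi j.1.1)].

Definition box (s : seq (K * nat * rat)) : set D :=
  [set xi | forall j, j \in s -> box_half j xi].

(** The boxes around xi generate a filter that converges to xi, which by the
    definition of the topology can be tested at one point b at a time: four half
    planes with bounds within ep / 2 confine xi b to a square inside a disc of
    radius ep. *)
Lemma box_nbhs (xi : D) (W : set D) :
  nbhs xi W -> exists2 s, box s xi & box s `<=` W.
Proof.
pose F : set_system D := filter_from [set s | box s xi] box.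
have FF : Filter F.
  apply: filter_from_filter; first by exists [::].
  move=> s t sx tx; exists (s ++ t).
    by move=> j; rewrite mem_cat => /orP[]; [exact: sx|exact: tx].
  by move=> chi h; split=> j js; apply: h; rewrite mem_cat js ?orbT.
suff Fxi : F --> xi by move=> /Fxi [s]; exists s.
have FG : Filter ((@dual_fun R K : D -> {ptws K -> R[i]^o}) @ F) by exact: fmap_filter.
have Gxi : (@dual_fun R K : D -> {ptws K -> R[i]^o}) @ F -->
    (dual_fun xi : {ptws K -> R[i]^o}).
  apply/cvg_sup => b U; rewrite nbhsE => -[_ [[A oA <-] /= Axi] AU].
  apply: filterS AU _.
  move: oA; rewrite openE => /(_ _ Axi) [ep /= ep0 eA].
  have ep_gt0 : 0 < Re ep by move: ep0; rewrite ltcE => /andP[].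
  have q_ k : exists q : rat, Re ('i%C ^+ k * xi b) - Re ep / 2 < ratr q
      /\ ratr q < Re ('i%C ^+ k * xi b).
    have [|q] := @rat_in_itvoo R (Re ('i%C ^+ k * xi b) - Re ep / 2) (Re ('i%C ^+ k * xi b)).
      by rewrite ltrBlDr ltrDl divr_gt0.
    by rewrite in_itv/= => /andP[? ?]; exists q.
  pose q k := projT1 (cid (q_ k)).
  have qP k := projT2 (cid (q_ k)); rewrite -/(q _) in qP.
  exists [seq (b, k, q k) | k <- iota 0 4].
    by move=> _ /mapP[k _ ->]; rewrite /box_half/=; have [] := qP k.
  move=> chi hchi; apply: eA => /=.
  have h k : (k < 4)%N -> Re ('i%C ^+ k * (xi b - chi b)) < Re ep / 2.
    move=> k4; have := hchi (b, k, q k).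
    rewrite map_f ?mem_iota// => /(_ isT); rewrite /box_half/= mulrBr.
    have -> : Re ('i%C ^+ k * xi b - 'i%C ^+ k * chi b) =
        Re ('i%C ^+ k * xi b) - Re ('i%C ^+ k * chi b).
      by case: (_ * xi b) (_ * chi b) => [x y] [x' y'].
    by have [+ _] := qP k; lra.
  have := h 0 isT; have := h 1 isT; have := h 2 isT; have := h 3 isT.
  rewrite -(RRe_real (gtr0_real ep0)) normc_def ltcR.
  have -> : 'i%C ^+ 3 = - 'i%C :> R[i] by rewrite exprS sqr_i mulrN1.
  rewrite expr0 expr1 sqr_i; case: (xi b - chi b) => x y; rewrite !mulc_Re /=.
  rewrite oppr0 !mul0r !mulN1r !mul1r !subr0 sub0r add0r opprK => y1 x1 y2 x2.
  rewrite -[ltRHS](ger0_norm (ltW ep_gt0)) -sqrtr_sqr ltr_sqrt ?exprn_gt0//.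
  move: (Re ep) ep_gt0 y1 x1 y2 x2 => E; nra.
by move=> {}W; rewrite nbhsE => -[_ [[V oV <-] Vxi] VW]; apply: filterS VW _;
  apply: (Gxi V); exact: open_nbhs_nbhs.
Qed.

Lemma half_plane_box_half j : half_plane ev (box_half j).
Proof. by exists j.1.1, ('i%C ^+ j.1.2), (ratr j.2). Qed.

(** The boxes form a countable base of the topology. *)
Lemma dual_measurable_half_plane : countable [set: K] ->
  (@measurable _ D : set (set D)) `<=` <<s half_plane ev >>.
Proof.
move=> Kc; apply: smallest_sub; first exact: smallest_sigma_algebra.
move=> W oW; pose I := [set s | box s `<=` W].
have -> : W = \bigcup_(s in I) box s.
  apply/seteqP; split; last by move=> xi [s Is /Is].
  move=> xi Wxi; have [|s sxi sW] := @box_nbhs xi W; first exact: open_nbhs_nbhs.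
  by exists s.
rewrite bigcup_mkcond.
apply: (@countable_bigcupT_measurable _ (g_sigma_algebraType (half_plane ev))).
  have /countable_injP[f fT] := Kc.
  have fI : injective f by move=> a b; apply: fT; rewrite in_setT.
  apply/countable_injP; pose g (j : K * nat * rat) := (f j.1.1, j.1.2, j.2).
  have gI : injective g by move=> [[a k] p] [[b k'] p'] [] /fI -> -> ->.
  exists (fun s => pickle (map g s)) => s s' _ _ /(pcan_inj pickleK).
  exact: (inj_map gI).
move=> s; case: ifP => // _; elim: s => [|j s IH].
  rewrite (_ : box [::] = setT); first exact: measurableT.
  by apply/seteqP; split.
rewrite (_ : box (j :: s) = box_half j `&` box s).
  by apply: measurableI => //; apply: sub_sigma_algebra; exact: half_plane_box_half.
apply/seteqP; split => [xi h|xi [h1 h2] k].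
  by split=> [|k ks]; apply: h; rewrite inE ?eqxx ?ks ?orbT.
by rewrite inE => /orP[/eqP->//|]; exact: h2.
Qed.

End dual_characters.

(** * Characters of the product of two duals *)

Lemma character_family_comp (R : realType) d d' (S : measurableType d)
    (T : measurableType d') (G : zmodType) (e : G -> T -> R[i]) (f : S -> T) :
  measurable_fun setT f -> character_family e ->
  character_family (fun g s => e g (f s)).
Proof.
move=> mf ce; split => [g s|g h s|g w]; first exact: char_norm.
  exact: charD.
exact: (measurableT_comp (measurable_char ce g w) mf).
Qed.

Lemma half_plane_comp (R : realType) d d' (S : measurableType d)
    (T : measurableType d') (G : zmodType) (e : G -> T -> R[i]) (f : S -> T)
    (U : set T) :
  <<s half_plane e >> U -> <<s half_plane (fun g s => e g (f s)) >> (f @^-1` U).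
Proof.
suff : <<s half_plane e >> `<=`
    [set V | <<s half_plane (fun g s => e g (f s)) >> (f @^-1` V)] by apply.
apply: smallest_sub => [|_ [g [w [r ->]]]]; last first.
  by apply: sub_sigma_algebra; exists g, w, r.
split => [|A|F] /=.
- by rewrite preimage_set0; exact: sigma_algebra0.
- by rewrite setTD preimage_setC; exact: sigma_algebraC.
- by move=> hF; rewrite preimage_bigcup; exact: sigma_algebra_bigcup.
Qed.

Section pair_characters.
Context (R : realType) (K : fieldType).
Local Notation D := (pdual R K).

Definition ev1 (b : K) (z : D * D) : R[i] := z.1 b.
Definition ev2 (b : K) (z : D * D) : R[i] := z.2 b.
Definition ev12 (p : K * K) (z : D * D) : R[i] := z.1 p.1 * z.2 p.2.

Lemma ev1_family : character_family ev1.
Proof. exact: (character_family_comp measurable_fst (@ev_family R K)). Qed.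

Lemma ev2_family : character_family ev2.
Proof. exact: (character_family_comp measurable_snd (@ev_family R K)). Qed.

Lemma ev12_family : character_family ev12.
Proof.
split => [p z|p q z|p w].
- by rewrite normrM !dual_norm mulr1.
- by rewrite /ev12 !dualD mulrACA.
(* Re (u v) = Re u Re v - Im u Im v, with Im z = Re (n z) for n = - i *)
pose n : R[i] := (0 -i* 1)%C.
have -> : (fun z : D * D => Re (w * ev12 p z)) =
    (fun z => Re (w * ev1 p.1 z) * Re (1 * ev2 p.2 z)) \-
    (fun z => Re ((n * w) * ev1 p.1 z) * Re (n * ev2 p.2 z)).
  apply/funext => z; rewrite /ev12 /ev1 /ev2 /n /=.
  by move: (z.1 p.1) (z.2 p.2) w => [a b] [a' b'] [x y] /=; ring.
by apply: measurable_funB; apply: measurable_funM;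
  first [exact: (measurable_char ev1_family)|exact: (measurable_char ev2_family)].
Qed.

Lemma half_plane_ev12 (A : set (D * D)) :
  half_plane ev1 A \/ half_plane ev2 A -> half_plane ev12 A.
Proof.
move=> [|] [b [w [r ->]]].
  exists (b, 0), w, r; apply/seteqP.
  by split=> z; rewrite /= /ev12 /ev1/= (char0 (@ev_family R K) z.2 : z.2 0 = 1) mulr1.
exists (0, b), w, r; apply/seteqP.
by split=> z; rewrite /= /ev12 /ev2/= (char0 (@ev_family R K) z.1 : z.1 0 = 1) mul1r.
Qed.

Lemma pair_measurable_half_plane : countable [set: K] ->
  (@measurable _ (D * D)%type : set (set (D * D))) `<=` <<s half_plane ev12 >>.
Proof.
move=> Kc; rewrite measurable_prod_measurableType.
apply: smallest_sub; first exact: smallest_sigma_algebra.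
move=> _ [A mA] [B mB] <-.
have mono (H : set (set (D * D))) : H `<=` half_plane ev12 ->
    <<s H >> `<=` <<s half_plane ev12 >>.
  by move=> HH; apply: sub_smallest2r => //; exact: smallest_sigma_algebra.
rewrite (_ : A `*` B = (fst @^-1` A) `&` (snd @^-1` B)) //.
apply: (@measurableI _ (g_sigma_algebraType (half_plane ev12))).
  apply: (mono (half_plane ev1)) => [U ?|]; first by apply: half_plane_ev12; left.
  by apply: (@half_plane_comp R _ _ (D * D)%type D K (@ev R K) fst A);
    exact: dual_measurable_half_plane.
apply: (mono (half_plane ev2)) => [U ?|]; first by apply: half_plane_ev12; right.
by apply: (@half_plane_comp R _ _ (D * D)%type D K (@ev R K) snd B);
    exact: dual_measurable_half_plane.
Qed.

Lemma pair_fourier_inj (P Q : probability (D * D)%type R) : countable [set: K] ->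
  (forall p, fourier ev12 P p = fourier ev12 Q p) -> P ≡μ Q.
Proof.
move=> Kc PQ U mU; apply: (fourier_inj ev12_family PQ).
exact: pair_measurable_half_plane.
Qed.

End pair_characters.

(** A complex number of modulus 1 is 1 as soon as its real part is at least 1, so
    the complement is a countable union of half planes. *)
Lemma char_trivial_measurable (R : realType) d (T : measurableType d) (G : zmodType)
    (e : G -> T -> R[i]) :
  countable [set: G] -> character_family e ->
  <<s half_plane e >> [set t | forall b, e b t = 1].
Proof.
move=> Kc ce; set E := [set t | _].
have -> : E = ~` \bigcup_(b in [set: G]) [set t | - 1 < Re (- 1 * e b t)].
  apply/seteqP; split => [t Et [b _]|t h b] /=; first by rewrite Et mulr1 /= ltxx.
  have {h} : 1 <= Re (e b t).
    rewrite leNgt; apply/negP => bt; apply: h; exists b => //=.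
    by rewrite mulN1r; case: (e b t) bt => x y /=; rewrite ltrN2.
  have := char_norm ce b t; case: (e b t) => x y; rewrite normc_def => -[] /=.
  move=> /(congr1 (fun x => x ^+ 2)).
  rewrite sqr_sqrtr ?addr_ge0 ?sqr_ge0// expr1n => xy1 x1.
  have -> : y = 0 by nra.
  by have -> : x = 1 by nra.
apply: (@measurableC _ (g_sigma_algebraType (half_plane e))).
rewrite bigcup_mkcond.
apply: (@countable_bigcupT_measurable _ (g_sigma_algebraType (half_plane e))) => // b.
by rewrite in_setT; apply: sub_sigma_algebra; exists b, (-1), (-1).
Qed.

(** * Characters separate points *)

Section partial_characters.
Context (V : zmodType) (C : numClosedFieldType).
Implicit Types (X : set (V * C)) (a b : V) (z w : C).

(** A homomorphism from a subgroup of V to the unit circle, given by its graph: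
    extension is then inclusion, and the union of a chain is a union of sets. *)
Record partial_character X : Prop := {
  pchar0 : X (0, 1);
  pcharB : forall a z b w, X (a, z) -> X (b, w) -> X (a - b, z / w);
  pchar_fun : forall z, X (0, z) -> z = 1;
  pchar_norm : forall a z, X (a, z) -> `|z| = 1
}.

Section one_partial_character.
Variables (X : set (V * C)) (pX : partial_character X).

Lemma pchar_neq0 a z : X (a, z) -> z != 0.
Proof. by move=> /(pchar_norm pX) z1; rewrite -normr_eq0 z1 oner_eq0. Qed.

Lemma pcharN a z : X (a, z) -> X (- a, z^-1).
Proof. by move=> /(pcharB pX (pchar0 pX)); rewrite sub0r div1r. Qed.

Lemma pcharD a z b w : X (a, z) -> X (b, w) -> X (a + b, z * w).
Proof. by move=> Xa /pcharN /(pcharB pX Xa); rewrite opprK invrK. Qed.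

Lemma pchar_inj a z w : X (a, z) -> X (a, w) -> z = w.
Proof.
move=> Xz Xw; have := pcharB pX Xz Xw; rewrite subrr => /(pchar_fun pX) zw.
by rewrite -[z](divfK (pchar_neq0 Xw)) zw mul1r.
Qed.

Lemma pcharMz a z (n : int) : X (a, z) -> X (a *~ n, z ^ n).
Proof.
move=> Xa; have nat_case (m : nat) : X (a *+ m, z ^+ m).
  elim: m => [|m IH]; first exact: (pchar0 pX).
  by rewrite mulrS exprS; exact: pcharD.
case: n => m; first exact: nat_case.
by rewrite NegzE mulrNz -exprnN; apply: pcharN; exact: nat_case.
Qed.

(** The integers n with b *~ n in the domain form a subgroup of the integers, hence
    are 0 alone or the multiples of the least positive one. *)
Lemma pchar_order b :
  (forall (n : int) z, X (b *~ n, z) -> n = 0) \/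
  exists (d : nat) (z0 : C), [/\ (0 < d)%N, X (b *+ d, z0) &
    forall (n : int) z, X (b *~ n, z) -> exists q : int, n = q * d /\ z = z0 ^ q].
Proof.
have [[d0 [d0_gt0 [z0 Xd0]]]|nd] := pselect
    (exists d : nat, (0 < d)%N /\ exists z, X (b *+ d, z)); last first.
  left=> n z Xn; apply: contrapT => n0; apply: nd.
  exists `|n|%N; split; first by rewrite absz_gt0; exact/eqP.
  case: n Xn {n0} => m Xm; first by exists z.
  by exists z^-1; move/pcharN: Xm; rewrite NegzE mulrNz opprK.
right.
have ex : exists d, `[< (0 < d)%N /\ exists z, X (b *+ d, z) >].
  by exists d0; apply/asboolP; split => //; exists z0.
have [d /asboolP[d_gt0 [z Xd]] dmin] := ex_minnP ex.
exists d, z; split => // n w Xn; exists (n %/ d)%Z.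
have r0 : (n %% d)%Z = 0.
  have dn0 : (d : int) != 0 by rewrite eqz_nat -lt0n.
  have Xr : X (b *~ (n %% d)%Z, w / z ^ (n %/ d)%Z).
    rewrite /modz mulrzBr [in X in _ - X]mulrC mulrzA.
    exact: (pcharB pX Xn (pcharMz (n %/ d)%Z Xd)).
  have := modz_ge0 n dn0; have := @ltz_pmod n d d_gt0.
  case rE : (n %% d)%Z Xr => [r|//] Xr rd _; congr Posz; apply/eqP.
  rewrite -leqn0 leqNgt; apply/negP => r_gt0; move: rd; rewrite ltz_nat ltnNge.
  by rewrite dmin//; apply/asboolP; split => //; exists (w / z ^ (n %/ d)%Z).
have nE : n = (n %/ d)%Z * d by rewrite {1}(divz_eq n d) r0 addr0.
split => //; apply: pchar_inj Xn _.
rewrite {1}nE mulrC mulrzA; exact: pcharMz.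
Qed.

Definition adjoin b w : set (V * C) :=
  [set p | exists a z (n : int), X (a, z) /\ p = (a + b *~ n, z * w ^ n)].

Lemma sub_adjoin b w : X `<=` adjoin b w.
Proof.
by move=> [a z] Xa; exists a, z, 0; rewrite mulr0z addr0 expr0z mulr1.
Qed.

Lemma adjoin_self b w : adjoin b w (b, w).
Proof.
by exists 0, 1, 1; rewrite mulr1z add0r mul1r expr1z; split => //; exact: pchar0.
Qed.

(** The condition on w makes the value at a multiple of b that lies in the domain
    the same in X and in the extension. *)
Lemma adjoin_partial_character b w : `|w| = 1 ->
  (forall (n : int) z, X (b *~ n, z) -> z = w ^ n) ->
  partial_character (adjoin b w).
Proof.
move=> w1 Xw; have w0 : w != 0 by rewrite -normr_eq0 w1 oner_eq0.
split.
- exact/sub_adjoin/(pchar0 pX).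
- move=> _ _ _ _ [a [z [n [Xa [-> ->]]]]] [a' [z' [n' [Xa' [-> ->]]]]].
  exists (a - a'), (z / z'), (n - n'); split; first exact: pcharB.
  rewrite mulrzBr opprD addrACA; congr (_, _).
  by rewrite expfzDr// invfM mulrACA invr_expz.
- move=> _ [a [z [n [Xa [/esym ab0 ->]]]]].
  have aE : a = b *~ (- n) by apply/eqP; rewrite mulrNz -addr_eq0 ab0.
  by rewrite aE in Xa; rewrite (Xw _ _ Xa) -expfzDr// addNr expr0z.
- move=> _ _ [a [z [n [Xa [_ ->]]]]]; rewrite normrM (pchar_norm pX Xa) mul1r.
  by case: n => m; rewrite ?NegzE -?exprnN ?normfV normrX w1 expr1n ?invr1.
Qed.

(** In the second case of pchar_order, any d-th root of z0 is a possible value at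
    b; there is one because C is algebraically closed. *)
Lemma pchar_extend b : exists w, `|w| = 1 /\
  forall (n : int) z, X (b *~ n, z) -> z = w ^ n.
Proof.
have [h|[d [z0 [d0 Xd h]]]] := pchar_order b.
  exists 1; rewrite normr1; split => // n z /[dup] /h ->.
  by rewrite mulr0z expr0z => /(pchar_fun pX).
exists (d.-root z0); have rK := rootCK d0 z0.
split; last by move=> n z /h[q [-> ->]]; rewrite mulrC -exprz_exp -exprnP rK.
apply/eqP; rewrite -(@pexpr_eq1 _ _ d)// -normrX rK.
by rewrite (pchar_norm pX Xd).
Qed.

End one_partial_character.

Lemma nontrivial_root_of_unity (d : nat) : (1 < d)%N ->
  exists2 w : C, w != 1 & w ^+ d = 1.
Proof.
move=> d1; pose p : {poly C} := \poly_(i < d) 1.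
have sp : size p = d by rewrite size_poly_eq ?oner_eq0.
have /closed_rootP[w /rootP] : size p != 1%N by rewrite sp gtn_eqF.
rewrite horner_poly => pw; exists w.
  apply/eqP => w1; move: pw; rewrite w1.
  under eq_bigr do rewrite expr1n mul1r.
  by rewrite sumr_const card_ord => /eqP; rewrite pnatr_eq0; case: d d1 {p sp}.
apply/eqP; rewrite -subr_eq0 subrX1; under eq_bigr do rewrite -[_ ^+ _]mul1r.
by rewrite pw mulr0.
Qed.

Lemma trivial_partial_character : partial_character [set (0, 1)].
Proof.
split => //.
- by move=> a z b w [-> ->] [-> ->] /=; rewrite subrr divr1.
- by move=> z [].
- by move=> a z [_ ->]; rewrite normr1.
Qed.

(** The starting point of the extension: on the cyclic group of b, send b to
    -1 if its order is infinite, and to a nontrivial d-th root of unity if its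
    order is d. *)
Lemma partial_character_nontrivial b : b != 0 ->
  exists w X, [/\ w != 1, partial_character X & X (b, w)].
Proof.
move=> b0; have pT := trivial_partial_character.
suff [w [w1 wn1 h]] : exists w : C, [/\ `|w| = 1, w != 1 &
    forall (n : int) z, [set (0 : V, 1 : C)] (b *~ n, z) -> z = w ^ n].
  exists w, (adjoin [set (0, 1)] b w); split => //.
    exact: adjoin_partial_character.
  exact: adjoin_self.
have [h|[d [z0 [d0 [bd z01] h]]]] := pchar_order pT b.
  exists (-1); rewrite normrN1; split => //.
    by rewrite eq_sym -addr_eq0 -mulr2n pnatr_eq0.
  by move=> n z /[dup] /h -> /(congr1 snd) /= ->; rewrite expr0z.
have [|w w1 wd] := @nontrivial_root_of_unity d.
  by case: d d0 bd {h} => [//|[|//]] _; rewrite mulr1n => /eqP; rewrite (negPf b0).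
exists w; split => //.
  by apply/eqP; rewrite -(@pexpr_eq1 _ _ d)// -normrX wd normr1.
by move=> n z /h[q [-> ->]]; rewrite mulrC -exprz_exp -exprnP wd z01 !exp1rz.
Qed.

(** A partial character of maximal domain is defined everywhere, since otherwise
    pchar_extend would extend it. *)
Lemma exists_character b : b != 0 -> exists chi : V -> C,
  [/\ forall a, `|chi a| = 1, forall a a', chi (a + a') = chi a * chi a' &
      chi b != 1].
Proof.
move=> /partial_character_nontrivial[w [X0 [w1 pX0 X0b]]].
(* the union of the empty chain is empty, hence the first case *)
pose P X := X = set0 \/ (partial_character X /\ X0 `<=` X).
have [|X [PX maxX]] := @Zorn_bigcup _ P.
  move=> F FP Ftot.
  have [[Y [FY Y0]]|F0] := pselect (exists Y, F Y /\ Y !=set0); last first.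
    left; apply/seteqP; split => // p [Y FY Yp]; apply: F0; exists Y; split => //.
    by exists p.
  have [Ye|[pY X0Y]] := FP _ FY; first by move: Y0; rewrite Ye => -[].
  have FP' Z p : F Z -> Z p -> partial_character Z.
    by move=> FZ Zp; have [Ze|[]//] := FP _ FZ; move: Zp; rewrite Ze.
  right; split; last by move=> p /X0Y Yp; exists Y.
  split.
  - by exists Y => //; exact: pchar0.
  - move=> a z b' w' [Z FZ Za] [Z' FZ' Zb].
    have [ZZ|ZZ] := Ftot _ _ FZ FZ'.
      by exists Z' => //; apply: (pcharB (FP' _ _ FZ' Zb) _ Zb); exact: ZZ.
    by exists Z => //; apply: (pcharB (FP' _ _ FZ Za) Za); exact: ZZ.
  - by move=> z [Z FZ Zz]; apply: (pchar_fun (FP' _ _ FZ Zz)).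
  - by move=> a z [Z FZ Zz]; apply: (pchar_norm (FP' _ _ FZ Zz) Zz).
have [X_0|[pX X0X]] := PX.
  exfalso; apply: (maxX X0); last by right; split.
  by rewrite X_0; split=> // /(_ _ X0b).
have tot a : exists z, X (a, z).
  have [z [z1 zP]] := pchar_extend pX a.
  exists z; apply: contrapT => nXa; apply: (maxX (adjoin X a z)).
    split; first exact: sub_adjoin.
    by move=> /(_ (a, z)) h; apply: nXa; apply: h; exact: adjoin_self.
  right; split; first exact: adjoin_partial_character.
  by move=> p /X0X; exact: sub_adjoin.
pose chi a := projT1 (cid (tot a)).
have chiP a : X (a, chi a) := projT2 (cid (tot a)).
exists chi; split => [a|a a'|]; first exact: pchar_norm (chiP a).
  by apply: (pchar_inj pX (chiP _)); exact: pcharD.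
by rewrite (pchar_inj pX (chiP b) (X0X _ X0b)).
Qed.

End partial_characters.

Lemma dual_separates (R : realType) (K : fieldType) (b : K) : b != 0 ->
  exists chi : pdual R K, chi b != 1.
Proof.
move=> /(@exists_character K R[i])[chi [chi1 chiD chib]].
by exists (Dual chi1 chiD).
Qed.

(** * Fourier coefficients, Haar measure and invariance *)

Section fourier_theory.
Context (R : realType) d (T : measurableType d) (G : zmodType).
Implicit Types e : G -> T -> R[i].

(** A complex number is determined by the real parts of its multiples. *)
Lemma fourierP e (P : probability T R) g z :
  (forall w, \int[P]_t Re (w * e g t) = Re (w * z)) -> fourier e P g = z.
Proof.
move=> h; rewrite /fourier.
under eq_Rintegral do rewrite -[e g _]mul1r.
under [X in _ +i* X]eq_Rintegral do rewrite Im_ReN.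
by rewrite !h -Im_ReN mul1r; case: z {h}.
Qed.

Lemma fourierN e (P : probability T R) g : character_family e ->
  fourier e P (- g) = conjc (fourier e P g).
Proof.
move=> ce; apply: fourierP => w.
have reJ (z z' : R[i]) : Re (z * conjc z') = Re (conjc z * z').
  by case: z z' => [x y] [x' y'] /=; ring.
under eq_Rintegral do rewrite (charN ce) reJ.
by rewrite (Rintegral_char ce) reJ.
Qed.

(** Away from 0 the coefficients of P are those of (1 - c) M + c dirac, and at 0
    all three are 1.  By fourier_combination the masses satisfy the same relation,
    in which M contributes 0 by trivial_char_null. *)
Lemma trivial_char_mass e (P M : probability T R) (c : R) (t0 : T) :
  character_family e -> countable [set: G] -> infinite_set [set: G] ->
  (forall g, g != 0 -> fourier e P g = c%:C) ->
  (forall g, g != 0 -> fourier e M g = 0) ->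
  (forall g, e g t0 = 1) ->
  fine (P [set t | forall g, e g t = 1]) = c.
Proof.
move=> ce Gc Ginf Pc M0 t01; set E := [set t | _].
have sE : <<s half_plane e >> E by exact: char_trivial_measurable.
have mE : measurable E by exact: half_plane_sigma_measurable sE.
have ME : M E = 0%E by apply: trivial_char_null => // g /M0 ->.
have d1 : fine (@dirac _ T t0 R E) = 1 by rewrite diracE mem_set.
have : fine (P E) + (- (1 - c) * fine (M E) + - c * fine (@dirac _ T t0 R E)) = 0.
  have := @fourier_combination _ _ _ _ _ ce
    [:: (1, P); (- (1 - c), M); (- c, dirac t0 : probability T R)] _ _ sE.
  rewrite !big_cons big_nil addr0 mul1r; apply => g.
  rewrite !big_cons big_nil (fourier_dirac ce) t01.
  have [->|g0] := eqVneq g 0.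
    by rewrite !(fourier0 ce) !mulr1 addr0 -!rmorphD/= (_ : _ + _ = 0)//; ring.
  rewrite Pc// M0// mulr0 addr0 mulr1 add0r mul1r.
  by rewrite -rmorphD/= subrr.
by rewrite d1 ME mulr0 add0r mulr1 => /eqP; rewrite subr_eq0 => /eqP.
Qed.

End fourier_theory.

Lemma fourier_ae (R : realType) d (T : measurableType d) (G G' : zmodType)
    (e : G -> T -> R[i]) (e' : G' -> T -> R[i]) (P : probability T R) g g' (E : set T) :
  character_family e -> character_family e' -> measurable E -> P E = 1%E ->
  (forall t, E t -> e g t = e' g' t) -> fourier e P g = fourier e' P g'.
Proof.
move=> ce ce' mE PE eE; apply: fourierP => w; rewrite -(Rintegral_char ce').
congr fine; apply: ae_eq_integral => //.
- exact/measurable_EFinP/measurable_char.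
- exact/measurable_EFinP/measurable_char.
exists (~` E); split; first exact: measurableC.
  by apply: (etrans (probability_setC P mE)); rewrite PE subee.
by move=> t /= h Et; apply: h => _; rewrite eE.
Qed.


Lemma fourier_comp (R : realType) d d' (S : measurableType d) (T : measurableType d')
    (G : zmodType) (e : G -> T -> R[i]) (f : S -> T)
    (P : probability S R) (Q : probability T R) g :
  character_family e -> measurable_fun setT f ->
  (forall A, measurable A -> Q A = P (f @^-1` A)) ->
  fourier e Q g = fourier (fun g s => e g (f s)) P g.
Proof.
move=> ce mf QP; apply: fourierP => w.
rewrite -(Rintegral_char (character_family_comp mf ce)); congr fine.
transitivity (\int[pushforward P f]_t (Re (w * e g t))%:E)%E.
  by apply: eq_measure_integral => A mA _; exact: QP.
rewrite integral_pushforward//.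
- exact/measurable_EFinP/(measurable_char ce).
- apply: bounded_measurable_integrable.
  exact: (bounded_measurable_char (character_family_comp mf ce)).
Qed.

Section dual_maps.
Context (R : realType) (K : fieldType).
Local Notation D := (pdual R K).
Hypothesis Kc : countable [set: K].

(** Half planes generate the Borel sets of the dual. *)
Lemma measurable_to_dual d (S : measurableType d) (f : S -> D) :
  (forall b w, measurable_fun setT (fun s => Re (w * f s b))) -> measurable_fun setT f.
Proof.
move=> hf; apply: (@measurability _ _ S D setT f (half_plane (@ev R K))).
  apply/seteqP; split; first exact: dual_measurable_half_plane.
  apply: smallest_sub; first exact: sigma_algebra_measurable.
  move=> _ [b [w [r ->]]]; have := measurable_char (@ev_family R K) b w.
  move=> /(_ measurableT `]r, +oo[%classic (measurable_itv _)).
  rewrite setTI; congr measurable; apply/seteqP.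
  by split => xi /=; rewrite in_itv/= andbT.
move=> _ [_ [b [w [r ->]]] <-].
have := hf b w measurableT `]r, +oo[%classic (measurable_itv _).
by congr measurable; apply/seteqP; split => s /=; rewrite in_itv/= andbT.
Qed.

Lemma measurable_dual_mul (chi : D) : measurable_fun setT (fun xi : D => (chi * xi)%g).
Proof.
apply: measurable_to_dual => b w.
under eq_fun do rewrite mulrA.
exact: (measurable_char (@ev_family R K)).
Qed.

Lemma measurable_dual_pull (a : K) : measurable_fun setT (@dual_pull R K a).
Proof. by apply: measurable_to_dual => b w; exact: (measurable_char (@ev_family R K)). Qed.

Lemma measurable_dual_act (a : K) : measurable_fun setT (@dual_act R K a).
Proof.
apply: measurable_fun_pair; apply: (measurableT_comp (measurable_dual_pull _)).
  exact: measurable_fst.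
exact: measurable_snd.
Qed.

(** Translation by chi multiplies the coefficient at b by chi b, and some
    character has chi b != 1. *)
Lemma fourier_haar (m : probability D R) : is_haar m ->
  forall b, fourier (@ev R K) m b = (b == 0)%:R.
Proof.
move=> hm b; have [->|b0] := eqVneq b 0; first exact: (fourier0 (@ev_family R K)).
have [chi chib] := @dual_separates R K b b0.
have : fourier (@ev R K) m b = chi b * fourier (@ev R K) m b.
  rewrite {1}(@fourier_comp _ _ _ D D K (@ev R K) (fun xi => (chi * xi)%g) m m b
    (@ev_family R K) (measurable_dual_mul chi)); last by move=> A mA; rewrite hm.
  apply: fourierP => w; under eq_Rintegral do rewrite /ev/= mulrA.
  by rewrite (Rintegral_char (@ev_family R K)) mulrA.
move=> /eqP; rewrite -subr_eq0 -[X in X - _]mul1r -mulrBl mulf_eq0 subr_eq0.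
by rewrite eq_sym (negPf chib) => /eqP.
Qed.

Lemma fourier_prod (P Q : probability D R) (p : K * K) :
  fourier (@ev12 R K) (P \x Q)%E p = fourier (@ev R K) P p.1 * fourier (@ev R K) Q p.2.
Proof.
apply: fourierP => w; pose f (z : D * D) := (Re (w * ev12 p z))%:E.
have bf := bounded_measurable_char (@ev12_family R K) p w.
have intf : (P \x Q)%E.-integrable setT f.
  exact: (@bounded_measurable_integrable _ _ _ ((P \x Q)%E : probability (D * D)%type R)).
rewrite /Rintegral -(integral12_prod_meas1 intf).
have -> : fubini_F Q f = fun xi : D => (Re (w * fourier (@ev R K) Q p.2 * ev p.1 xi))%:E.
  apply/funext => xi; rewrite /fubini_F /f /ev12 /=.
  under eq_integral do rewrite mulrA.
  rewrite mulrAC -(Rintegral_char (@ev_family R K)) fineK//.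
  apply: integrable_fin_num => //; apply: bounded_measurable_integrable.
  exact: (bounded_measurable_char (@ev_family R K)).
by rewrite -/(Rintegral _ _ _) (Rintegral_char (@ev_family R K)) mulrAC mulrA.
Qed.

Lemma fourier_ev1 (P : probability (D * D)%type R) b :
  fourier (@ev1 R K) P b = fourier (@ev12 R K) P (b, 0).
Proof.
apply: fourierP => w; rewrite -(Rintegral_char (@ev12_family R K)).
apply: eq_Rintegral => z _.
by rewrite /ev12 /ev1/= (char0 (@ev_family R K) z.2 : z.2 0 = 1) mulr1.
Qed.

Lemma fourier_ev2 (P : probability (D * D)%type R) b :
  fourier (@ev2 R K) P b = fourier (@ev12 R K) P (0, b).
Proof.
apply: fourierP => w; rewrite -(Rintegral_char (@ev12_family R K)).
apply: eq_Rintegral => z _.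
by rewrite /ev12 /ev2/= (char0 (@ev_family R K) z.1 : z.1 0 = 1) mul1r.
Qed.

Lemma fourier_act (mu : probability (D * D)%type R) (a : K) (p : K * K) :
  act_invariant mu -> a != 0 ->
  fourier (@ev12 R K) mu (a * p.1, a^-1 * p.2) = fourier (@ev12 R K) mu p.
Proof.
move=> mu_inv a0; symmetry.
apply: (@fourier_comp _ _ _ _ _ _ (@ev12 R K) (dual_act a) mu mu p).
- exact: ev12_family.
- exact: measurable_dual_act.
- by move=> A mA; rewrite mu_inv.
Qed.

(** The image of mu under the action of a has the coefficients of mu, hence equals
    mu. *)
Lemma fourier_act_invariant (mu : probability (D * D)%type R) :
  (forall (a : K) p, a != 0 ->
    fourier (@ev12 R K) mu (a * p.1, a^-1 * p.2) = fourier (@ev12 R K) mu p) ->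
  act_invariant mu.
Proof.
move=> h a a0 A mA.
pose f : {mfun (D * D)%type >-> (D * D)%type} := mfun_Sub (mem_set (measurable_dual_act a)).
suff : (distribution mu f : probability _ R) ≡μ mu by apply.
apply: pair_fourier_inj => // p.
rewrite (@fourier_comp _ _ _ _ _ _ (@ev12 R K) (dual_act a) mu) //;
  last exact: measurable_dual_act.
  exact: h.
exact: ev12_family.
Qed.

(** The action of -1 maps the index p to - p, and the coefficient at - p is the
    conjugate of the one at p. *)
Lemma fourier_act_real (mu : probability (D * D)%type R) p :
  act_invariant mu -> fourier (@ev12 R K) mu p = (Re (fourier (@ev12 R K) mu p))%:C.
Proof.
move=> mu_inv; have : conjc (fourier (@ev12 R K) mu p) = fourier (@ev12 R K) mu p.
  rewrite -(fourierN _ _ (@ev12_family R K)).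
  rewrite -[RHS](@fourier_act mu (-1))// ?oppr_eq0 ?oner_eq0//.
  by rewrite invrN invr1 !mulN1r.
by case: (fourier _ mu p) => x y [] yN; congr (_ +i* _); move: yN => /=; lra.
Qed.

End dual_maps.

(** * Vanishing of the mixed coefficients *)

Section spread_out.
Variable K : fieldType.
Hypothesis Kinf : infinite_set [set: K].

Lemma infinite_field_nonroot (p : {poly K}) : p != 0 -> exists c, ~~ root p c.
Proof.
move=> p0; have [B _ pB] := infinite_set_fset (size p) Kinf.
apply: contrapT => h.
have pB0 : all (root p) (finmap.enum_fset B).
  by apply/allP => c _; apply: contrapT => /negP pc; apply: h; exists c.
by have := max_poly_roots p0 pB0 (finmap.fset_uniq B); rewrite ltnNge pB.
Qed.

(** B stands for the finitely many points where psi is large.  To extend s, a new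
    element c has to avoid 0, the elements of s, and for each d in s and u in B
    the roots of t (X - d)^2 + u d X, a nonzero polynomial since its value at 0 is
    t d^2. *)
Lemma exists_spread (t : K) (B : seq K) (n : nat) : t != 0 ->
  exists s : seq K, [/\ size s = n, uniq s, 0 \notin s &
    {in s &, forall c d, c != d -> - (t * (c - d) ^+ 2 / (c * d)) \notin B}].
Proof.
move=> t0; elim: n => [|n [s [sn us s0 sB]]]; first by exists [::]; split.
pose q (d u : K) : {poly K} := t *: ('X - d%:P) ^+ 2 + (u * d) *: 'X.
pose p := 'X * \prod_(d <- s) ('X - d%:P) * \prod_(d <- s) \prod_(u <- B) q d u.
have q0 d u : d \in s -> q d u != 0.
  move=> ds; apply: contraNneq s0 => /(congr1 (horner^~ 0)).
  rewrite /= /q !hornerE /= => /eqP.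
  by rewrite !mulf_eq0 (negPf t0) /= oppr_eq0 orbb => /eqP <-.
have p0 : p != 0.
  rewrite !mulf_neq0 ?polyX_eq0//; rewrite prodf_seq_neq0; apply/allP => d ds /=.
    by rewrite polyXsubC_eq0.
  by rewrite prodf_seq_neq0; apply/allP => u _ /=; exact: q0.
have [c] := infinite_field_nonroot p0.
rewrite /p !rootM rootX !negb_or => /andP[/andP[c0 cs] cq].
have {}cs : c \notin s by rewrite root_prod_XsubC in cs.
have cB d : d \in s -> - (t * (c - d) ^+ 2 / (c * d)) \notin B.
  move=> ds; apply: contraNN cq => uB; rewrite /root horner_prod.
  rewrite prodf_seq_eq0; apply/hasP; exists d => //=.
  rewrite horner_prod prodf_seq_eq0; apply/hasP; exists (- (t * (c - d) ^+ 2 / (c * d))) => //=.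
  have d0 : d != 0 by apply: contraNneq s0 => <-.
  by rewrite /q !hornerE /=; apply/eqP; field; rewrite d0 c0.
exists (c :: s); split; rewrite ?inE ?negb_or/= ?sn ?cs ?us// ?[0 == c]eq_sym ?c0 ?s0//.
move=> a b; rewrite !inE => /orP[/eqP->|as_] /orP[/eqP->|bs] //.
- by rewrite eqxx.
- by move=> _; exact: cB.
- by move=> _; rewrite -[a - c]opprB sqrrN [a * c]mulrC; exact: cB.
- exact: sB.
Qed.

End spread_out.

Section vanishing.
Context (R : realType) (K : fieldType).
Local Notation D := (pdual R K).
Hypothesis Kc : countable [set: K].
Hypothesis Kinf : infinite_set [set: K].
Variable mu : probability (D * D)%type R.
Hypothesis mu_inv : act_invariant mu.
Hypothesis mu1 : forall x, x != 0 -> fourier (@ev12 R K) mu (x, 0) = 0.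
Local Notation phi p := (Re (fourier (@ev12 R K) mu p)).
Local Notation psi t := (phi (t, 1)).

Lemma phi_psi (x y : K) : y != 0 -> phi (x, y) = psi (x * y).
Proof.
move=> y0; rewrite -(@fourier_act R K Kc mu y (x, y))//=.
by rewrite mulVf// mulrC.
Qed.

(** The differences of the indices (t, 1) have second coordinate 0, where the
    coefficients vanish: the characters with these indices are orthonormal. *)
Lemma psi_bessel (s : seq K) : uniq s -> \sum_(t <- s) psi t ^+ 2 <= 1.
Proof.
move=> us; have := @fourier_bessel _ _ _ _ _ (@ev12_family R K) mu [seq (t, 1) | t <- s].
rewrite big_map; apply; first by rewrite map_inj_uniq// => a b [].
move=> _ _ /mapP[a _ ->] /mapP[b _ ->] ab.
rewrite (_ : _ - _ = (a - b, 0)); last by congr (_, _); rewrite subrr.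
by rewrite mu1// subr_eq0; apply: contraNneq ab => ->.
Qed.

(** By psi_bessel, fewer than ep^(-2) + 1 points t satisfy ep < psi t. *)
Lemma psi_finite (ep : R) : 0 < ep -> exists B : seq K, forall t, ep < psi t -> t \in B.
Proof.
move=> ep0; have [/finite_seqP[B hB]|inf] := pselect (finite_set [set t | ep < psi t]).
  by exists B => t ht; have : [set` B] t by rewrite -hB.
exfalso; have [B Bt nB] := infinite_set_fset (Num.trunc (ep ^- 2)).+1 inf.
have := psi_bessel (finmap.fset_uniq B); apply/negP; rewrite -ltNge.
apply: (@lt_le_trans _ _ (\sum_(t <- finmap.enum_fset B) ep ^+ 2)).
  rewrite big_const_seq count_predT iter_addr_0 -mulr_natl -ltr_pdivrMr ?exprn_gt0// div1r.
  by rewrite (lt_le_trans (truncnS_gt _))// ler_nat.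
rewrite big_seq [leRHS]big_seq; apply: ler_sum => t tB.
have /ltW := Bt t tB => /=; move=> h; rewrite ler_pXn2r// nnegrE ltW//.
exact: lt_le_trans h.
Qed.

(** The n points (c x, y / c) have the same coefficient r, while the coefficients
    at their differences are at most ep = r^2 / 3; hence r^2 <= 1/n + r^2 / 3,
    which fails for n > 3 / r^2 unless r = 0. *)
Lemma phi_vanish (x y : K) : x != 0 -> y != 0 -> phi (x, y) = 0.
Proof.
move=> x0 y0; have xy0 : x * y != 0 by rewrite mulf_neq0.
set r := phi (x, y); apply/eqP; apply: contraT => r0.
have r2 : 0 < r ^+ 2 by rewrite exprn_even_gt0.
pose ep := r ^+ 2 / 3; have ep0 : 0 < ep by rewrite divr_gt0.
have [B hB] := psi_finite ep0.
have [s [sn us s0 sB]] := exists_spread Kinf B (Num.trunc (3 / r ^+ 2)).+1 xy0.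
pose pt c : K * K := (c * x, c^-1 * y).
have := @fourier_almost_orthogonal _ _ _ _ _ (@ev12_family R K) mu [seq pt c | c <- s] ep r.
rewrite size_map sn; move=> /(_ _ _ _ _ isT) h.
pose N : R := (Num.trunc (3 / r ^+ 2)).+1%:R.
suff : r ^+ 2 <= N^-1 + ep.
  have hN : 3 / r ^+ 2 < N := truncnS_gt _.
  have N0 : 0 < N by rewrite ltr0Sn.
  have : N^-1 < ep by rewrite invf_plt ?posrE// invf_div.
  by rewrite /ep; move: (N^-1) => M h1 h2; exfalso; lra.
apply: h.
- by rewrite map_inj_in_uniq// => c d _ _ [] /(mulIf x0).
- exact: ltW.
- move=> _ _ /mapP[c cs ->] /mapP[d ds ->] cd.
  have {}cd : c != d by apply: contraNneq cd => ->.
  have c0 : c != 0 by apply: contraNneq s0 => <-.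
  have d0 : d != 0 by apply: contraNneq s0 => <-.
  rewrite leNgt; apply/negP => h; have := sB c d cs ds cd; apply/negP/negPn.
  apply: hB; move: h; rewrite (_ : pt c - pt d = (c * x - d * x, c^-1 * y - d^-1 * y))//.
  rewrite phi_psi; last by rewrite -mulrBl mulf_neq0// subr_eq0 (inj_eq invr_inj).
  suff -> : (c * x - d * x) * (c^-1 * y - d^-1 * y) =
    - (x * y * (c - d) ^+ 2 / (c * d)) by [].
  by field; rewrite d0 c0.
- move=> _ /mapP[c cs ->]; have c0 : c != 0 by apply: contraNneq s0 => <-.
  by rewrite /pt (@fourier_act R K Kc mu c (x, y)).
Qed.

End vanishing.

(** * Classification *)

Lemma conditional_probabilityE (R : realType) d (T : measurableType d)
    (P : probability T R) (A : set T) (mA : measurable A) U : P A != 0%E ->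
  mnormalize (mrestr P mA) P U = (P (U `&` A) * (fine (P A))^-1%:E)%E.
Proof.
move=> PA0; have evid : mrestr P mA setT = P A := congr1 P (setTI A).
rewrite /mnormalize /= evid (negPf PA0) /= ifF//.
by rewrite lt_eqF// ltey_eq fin_num_measure.
Qed.

Section classification.
Context (R : realType) (K : fieldType).
Local Notation D := (pdual R K).
Hypothesis Kc : countable [set: K].
Hypothesis Kinf : infinite_set [set: K].
Variable m : probability D R.
Hypothesis haar_m : is_haar m.
Implicit Types mu : probability (D * D)%type R.

Definition trivial1 : set (D * D) := [set z | forall b, ev1 b z = 1].
Definition trivial2 : set (D * D) := [set z | forall b, ev2 b z = 1].

Lemma measurable_trivial1 : measurable trivial1.
Proof.
apply: (half_plane_sigma_measurable (@ev1_family R K)).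
exact: (char_trivial_measurable Kc (@ev1_family R K)).
Qed.

Lemma measurable_trivial2 : measurable trivial2.
Proof.
apply: (half_plane_sigma_measurable (@ev2_family R K)).
exact: (char_trivial_measurable Kc (@ev2_family R K)).
Qed.

Lemma act_trivial1 (a : K) : a != 0 -> dual_act a @^-1` trivial1 = trivial1.
Proof.
move=> a0; apply/seteqP; split => z h b; last exact: (h (a * b)).
by have := h (a^-1 * b); rewrite /ev1/= mulVKf.
Qed.

Lemma act_trivial2 (a : K) : a != 0 -> dual_act a @^-1` trivial2 = trivial2.
Proof.
move=> a0; apply/seteqP; split => z h b; last exact: (h (a^-1 * b)).
by have := h (a * b); rewrite /ev2/= mulKf.
Qed.

Definition factor (al : bool) : probability D R :=
  if al then (dirac (1%g : D) : probability D R) else m.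

(** The coefficients of factor al: constantly 1 for the point mass, and the
    indicator of 0 for the Haar measure. *)
Definition factor_coef (al : bool) (b : K) : R[i] := ((al || (b == 0))%:R : R)%:C.

Lemma fourier_factor al b : fourier (@ev R K) (factor al) b = factor_coef al b.
Proof.
rewrite /factor /factor_coef; case: al => /=.
  by rewrite (fourier_dirac (@ev_family R K)).
by rewrite fourier_haar//; case: (b == 0).
Qed.

Lemma factor_coefMl al (a b : K) : a != 0 -> factor_coef al (a * b) = factor_coef al b.
Proof. by move=> a0; rewrite /factor_coef mulf_eq0 (negPf a0). Qed.

Local Notation prod al be := ((factor al \x factor be)%E : probability (D * D)%type R).

Lemma fourier_factors al be p :
  fourier (@ev12 R K) (prod al be) p = factor_coef al p.1 * factor_coef be p.2.
Proof. by rewrite fourier_prod !fourier_factor. Qed.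

Lemma prod_invariant al be : act_invariant (prod al be).
Proof.
apply: fourier_act_invariant => // a p a0.
by rewrite !fourier_factors/= !factor_coefMl// invr_eq0.
Qed.

(** The comparison measure of trivial_char_mass is the Haar measure on the first
    coordinate. *)
Lemma mass_trivial1 mu (c : R) :
  (forall b, b != 0 -> fourier (@ev12 R K) mu (b, 0) = c%:C) -> fine (mu trivial1) = c.
Proof.
move=> h; apply: (@trivial_char_mass _ _ _ _ _ mu (prod false true) c
  ((1%g : D), (1%g : D)) (@ev1_family R K)) => //.
  by move=> b b0; rewrite fourier_ev1 h.
by move=> b b0; rewrite fourier_ev1 fourier_factors /factor_coef/= (negPf b0) mul0r.
Qed.

Lemma mass_trivial2 mu (c : R) :
  (forall b, b != 0 -> fourier (@ev12 R K) mu (0, b) = c%:C) -> fine (mu trivial2) = c.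
Proof.
move=> h; apply: (@trivial_char_mass _ _ _ _ _ mu (prod true false) c
  ((1%g : D), (1%g : D)) (@ev2_family R K)) => //.
  by move=> b b0; rewrite fourier_ev2 h.
by move=> b b0; rewrite fourier_ev2 fourier_factors /factor_coef/= (negPf b0) mulr0.
Qed.

Lemma prod_trivial1 al be : prod al be trivial1 = (al%:R)%:E.
Proof.
rewrite -[LHS]fineK ?fin_num_measure//; last exact: measurable_trivial1.
congr EFin; apply: mass_trivial1 => b b0.
by rewrite fourier_factors /factor_coef/= eqxx (negPf b0) orbF orbT mulr1.
Qed.

Lemma prod_trivial2 al be : prod al be trivial2 = (be%:R)%:E.
Proof.
rewrite -[LHS]fineK ?fin_num_measure//; last exact: measurable_trivial2.
congr EFin; apply: mass_trivial2 => b b0.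
by rewrite fourier_factors /factor_coef/= eqxx (negPf b0) orbF orbT mul1r.
Qed.

(** If mu is carried by xi1 = 1, the mixed coefficient at (x, y) is the one at
    (0, y); likewise on the other side.  If both masses are 0, the mixed
    coefficients vanish by phi_vanish. *)
Lemma invariant_classification mu (al be : bool) : act_invariant mu ->
  mu trivial1 = (al%:R)%:E -> mu trivial2 = (be%:R)%:E -> mu ≡μ prod al be.
Proof.
move=> mu_inv mu1 mu2.
pose F p := fourier (@ev12 R K) mu p.
have Freal p : F p = (Re (F p))%:C by exact: fourier_act_real.
have Fact a p : a != 0 -> F (a * p.1, a^-1 * p.2) = F p by move=> a0; exact: fourier_act.
have F1 b : b != 0 -> F (b, 0) = (al%:R)%:C.
  have hF c : c != 0 -> F (c, 0) = (Re (F (1, 0)))%:C.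
    by move=> c0; rewrite -Freal -(Fact c (1, 0))//= mulr1 mulr0.
  by move=> b0; rewrite hF// -(mass_trivial1 hF) mu1.
have F2 b : b != 0 -> F (0, b) = (be%:R)%:C.
  have hF c : c != 0 -> F (0, c) = (Re (F (0, 1)))%:C.
    move=> c0; rewrite -Freal -(Fact c^-1 (0, 1)) ?invr_eq0//=.
    by rewrite mulr0 invrK mulr1.
  by move=> b0; rewrite hF// -(mass_trivial2 hF) mu2.
apply: pair_fourier_inj => // -[x y]; rewrite fourier_factors -/(F _) /factor_coef /=.
have [->|x0] := eqVneq x 0.
  rewrite orbT mul1r; have [->|y0] := eqVneq y 0; last by rewrite orbF F2.
  by rewrite orbT; exact: (fourier0 (@ev12_family R K)).
have [->|y0] := eqVneq y 0; first by rewrite orbT mulr1 orbF F1.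
rewrite !orbF; case: al be mu1 mu2 F1 F2 => [] be mu1 mu2 F1 F2.
  rewrite mul1r -[RHS](F2 _ y0) /F -fourier_ev2.
  apply: (fourier_ae (@ev12_family R K) (@ev2_family R K) measurable_trivial1 mu1).
  by move=> z hz; rewrite /ev12 /ev2 /= (hz x : z.1 x = 1) mul1r.
rewrite mul0r; case: be mu2 F2 => mu2 F2.
  rewrite -[RHS](F1 _ x0) /F -fourier_ev1.
  apply: (fourier_ae (@ev12_family R K) (@ev1_family R K) measurable_trivial2 mu2).
  by move=> z hz; rewrite /ev12 /ev1 /= (hz y : z.2 y = 1) mulr1.
by rewrite Freal /F (phi_vanish Kc Kinf mu_inv F1).
Qed.

(** The conditional measure on an invariant set A is invariant and absolutely
    continuous, so it gives trivial1 and trivial2 the same mass 0 or 1 as the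
    product does.  By the classification it is the product itself, and its value
    at A is 1. *)
Lemma act_ergodic_prod (al be : bool) : act_ergodic (prod al be).
Proof.
move=> A mA Ainv; set nu := prod al be.
have [->|nuA0] := eqVneq (nu A) 0%E; [by left|right].
have nuA_fin : nu A \is a fin_num by exact: fin_num_measure.
pose rho : probability (D * D)%type R := mnormalize (mrestr nu mA) nu.
have rhoE U : rho U = (nu (U `&` A) * (fine (nu A))^-1%:E)%E.
  exact: conditional_probabilityE.
have rhoA : rho A = 1%E.
  rewrite rhoE setIid -[X in (X * _)%E](fineK nuA_fin) -EFinM divff//.
  by rewrite fine_eq0.
have null U : measurable U -> nu U = 0%E -> rho U = 0%E.
  move=> mU U0; rewrite rhoE (_ : nu (U `&` A) = 0%E) ?mul0e//.
  by apply: (subset_measure0 _ _ _ U0) => //; exact: measurableI.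
(* for mass 1, absolute continuity is applied to the complement *)
have full (b : bool) U : measurable U -> nu U = (b%:R)%:E -> rho U = (b%:R)%:E.
  case: b => mU Ub; last exact: null.
  have : rho (~` U) = 0%E.
    apply: null; first exact: measurableC.
    by apply: (etrans (probability_setC nu mU)); rewrite Ub subee.
  move=> h; have := probability_setC rho (measurableC mU).
  by rewrite setCK h sube0.
have rho_inv : act_invariant rho.
  move=> a a0 U mU; rewrite !rhoE; congr (_ * _)%E.
  have := @prod_invariant al be a a0 _ (measurableI _ _ mU mA).
  by rewrite preimage_setI Ainv.
have := @invariant_classification rho al be rho_inv
  (full _ _ measurable_trivial1 (prod_trivial1 al be))
  (full _ _ measurable_trivial2 (prod_trivial2 al be)).
by move=> /(_ A mA) rhonu; exact: etrans (esym rhonu) rhoA.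
Qed.

Lemma act_eq_transfer mu (nu : probability (D * D)%type R) : mu ≡μ nu ->
  act_invariant nu /\ act_ergodic nu -> act_invariant mu /\ act_ergodic mu.
Proof.
move=> e [inv erg]; split.
  move=> a a0 A mA; rewrite !e//; first exact: inv.
  by rewrite -[X in measurable X]setTI; exact: measurable_dual_act.
by move=> A mA Ainv; rewrite e//; exact: erg.
Qed.

Lemma invariant_ergodicP mu : act_invariant mu /\ act_ergodic mu <->
  exists al be : bool, mu ≡μ prod al be.
Proof.
split=> [[inv erg]|[al [be e]]]; last first.
  apply: act_eq_transfer e _; split; [exact: prod_invariant|exact: act_ergodic_prod].
have E1 : exists al : bool, mu trivial1 = (al%:R)%:E.
  by case: (erg _ measurable_trivial1 act_trivial1) => ->; [exists false|exists true].
have E2 : exists be : bool, mu trivial2 = (be%:R)%:E.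
  by case: (erg _ measurable_trivial2 act_trivial2) => ->; [exists false|exists true].
case: E1 E2 => al ? [be ?]; exists al, be; exact: invariant_classification.
Qed.

Lemma prod_inj (al be al' be' : bool) :
  prod al be ≡μ prod al' be' -> al = al' /\ be = be'.
Proof.
have natb_inj (b b' : bool) : b%:R = b'%:R :> R -> b = b'.
  by move=> /eqP; rewrite eqr_nat; case: b b' => -[].
move=> e.
have := etrans (esym (prod_trivial1 al be))
  (etrans (e _ measurable_trivial1) (prod_trivial1 al' be')).
have := etrans (esym (prod_trivial2 al be))
  (etrans (e _ measurable_trivial2) (prod_trivial2 al' be')).
by move=> [/natb_inj ->] [/natb_inj ->].
Qed.

End classification.

Local Close Scope complex_scope.
Local Close Scope ring_scope.
Theorem corollary1p6 (R : realType) (K : fieldType)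
    (Kcountable : countable [set: K]) (Kinfinite : infinite_set [set: K])
    (m : probability (pdual R K) R) (haar_m : is_haar m) :
  let d1 : probability (pdual R K) R := dirac (1%g : pdual R K) in
  (forall mu : probability (pdual R K * pdual R K)%type R,
     act_invariant mu /\ act_ergodic mu <->
     [\/ mu ≡μ d1 \x d1, mu ≡μ d1 \x m, mu ≡μ m \x d1 | mu ≡μ m \x m]) /\
  ([/\ ~ d1 \x d1 ≡μ d1 \x m, ~ d1 \x d1 ≡μ m \x d1 & ~ d1 \x d1 ≡μ m \x m] /\
   [/\ ~ d1 \x m ≡μ m \x d1, ~ d1 \x m ≡μ m \x m & ~ m \x d1 ≡μ m \x m]).
Proof.
move=> d1.
have distinct := prod_inj Kcountable Kinfinite haar_m.
split; last first.
  split; split => e.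
  - by have [] := distinct true true true false e.
  - by have [] := distinct true true false true e.
  - by have [] := distinct true true false false e.
  - by have [] := distinct true false false true e.
  - by have [] := distinct true false false false e.
  - by have [] := distinct false true false false e.
move=> mu; have [to_prod of_prod] := invariant_ergodicP Kcountable Kinfinite haar_m mu.
split => [/to_prod[al [be]]|h].
  by case: al be => -[] e; [apply: Or41|apply: Or42|apply: Or43|apply: Or44].
apply: of_prod.
case: h => e; [exists true, true|exists true, false|exists false, true|exists false, false];
  exact: e.
Qed.
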